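(* Let $G$ be a finitely generated group with a finite generating subset $S$. Assume that $G$ has an infinite normal subgroup $H$ such that $(G,H)$ has relative Property T. Then for any nested sequence $G=N_0\trianglerighteq N_1\trianglerighteq\cdots$ of normal finite index subgroups of $G$ such that $\bigcap_{n=0}^\infty N_n=\{e\}$, the box space associated to $S$ and to $(N_n)_{n\in\mathbb{N}}$ does not coarsely embed into any uniformly curved Banach space.
   Context: Box space: given a finite generating subset $S$ of $G$ and a nested sequence of finite index normal subgroups $G=N_0\trianglerighteq N_1\trianglerighteq\cdots$ with trivial intersection, the box space is the sequence of Cayley graphs $(G/N_n,d_{S_n})$, where $S_n$ is $S$ modulo $N_n$ and $d_{S_n}$ is the word metric. Coarse embedding: a sequence of maps $\phi_n\colon X_n\to Y$ from metric spaces $(X_n,d_n)$ to a metric space $(Y,d_Y)$ is a coarse embedding of $(X_n)$ into $Y$ if there are two proper functions $\rho,\gamma\colon[0,\infty)\to[0,\infty)$ (independent of $n$) with $\rho(d_n(x,y))\leqslant d_Y(\phi_n(x),\phi_n(y))\leqslant\gamma(d_n(x,y))$ for all $n$ and all $x,y\in X_n$. Relative Property T: the pair $(G,H)$ has relative Property T if for every orthogonal representation $(\mathcal{H},\pi)$ of $G$ in a Hilbert space and every sequence of unit vectors $v_n\in\mathcal{H}$ with $\|\pi(g)v_n-v_n\|\to0$ for all $g\in G$, one has $\sup_{h\in H}\|\pi(h)v_n-v_n\|\to0$. Uniformly curved Banach space: a Banach space $X$ for which there is a function $\varepsilon\mapsto\Delta_X(\varepsilon)$ tending to $0$ as $\varepsilon\to0^+$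 such that, for every measure space $(\Omega,\mu)$, every operator $T\colon L^2(\Omega,\mu)\to L^2(\Omega,\mu)$ with $\|T\|\leqslant\varepsilon$ that is simultaneously of norm $\leqslant1$ on $L^1$ and on $L^\infty$ has norm $\leqslant\Delta_X(\varepsilon)$ on $L^2(\Omega,\mu,X)$, the Banach space of square-summable measurable functions $\Omega\to X$. *)

(* Defs.v *)
From HB Require Import structures.
From mathcomp Require Import all_boot all_order all_algebra.
From mathcomp Require Import all_classical all_reals all_analysis.

Set Implicit Arguments.
Unset Strict Implicit.
Unset Printing Implicit Defensive.

Import Order.TTheory GRing.Theory Num.Theory.
Import numFieldNormedType.Exports.

Local Open Scope classical_set_scope.
Local Open Scope quotient_scope.
Local Open Scope ring_scope.

Record normalSubgroup (G : groupType) := NormalSubgroup {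
  nsg_carrier :> set G;
  nsg_group_closed : group_closed (mem nsg_carrier);
  nsg_conj : forall x g, nsg_carrier x -> nsg_carrier (x ^ g)%g }.

Section Quotient.
Variables (G : groupType) (N : normalSubgroup G).
Local Open Scope group_scope.
Implicit Types x y z : G.

Lemma nsg1 : nsg_carrier N 1.
Proof. by have [/set_mem] := nsg_group_closed N. Qed.

Lemma nsgM x y : nsg_carrier N x -> nsg_carrier N y -> nsg_carrier N (x * y).
Proof.
move=> Nx Ny; apply/set_mem/(group_closedM (nsg_group_closed N));
  exact/mem_set.
Qed.

Lemma nsgV x : nsg_carrier N x -> nsg_carrier N x^-1.
Proof.
by move=> Nx; apply/set_mem/(group_closedV (nsg_group_closed N))/mem_set.
Qed.

Definition coset_rel : rel G := fun x y => `[< nsg_carrier N (x^-1 * y) >].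

Let coset_rel_refl : reflexive coset_rel.
Proof. by move=> x; apply/asboolP; rewrite mulVg; exact: nsg1. Qed.

Let coset_rel_symm : symmetric coset_rel.
Proof.
by move=> x y; apply/idP/idP => /asboolP/nsgV; rewrite invgM invgK => ?;
  apply/asboolP.
Qed.

Let coset_rel_transitive : transitive coset_rel.
Proof.
move=> y x z /asboolP Nxy /asboolP Nyz; apply/asboolP.
by have := nsgM Nxy Nyz; rewrite mulgA mulgK.
Qed.

Canonical coset_equiv :=
  EquivRel coset_rel coset_rel_refl coset_rel_symm coset_rel_transitive.

Definition quotientGroup : Type := {eq_quot coset_equiv}.
HB.instance Definition _ := Choice.on quotientGroup.
HB.instance Definition _ := EqQuotient.on quotientGroup.

Definition coset_proj : G -> quotientGroup := \pi_quotientGroup.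

Lemma coset_projP x y : coset_proj x = coset_proj y <-> nsg_carrier N (x^-1 * y).
Proof.
split=> [/eqP|Nxy]; first by rewrite eqmodE => /asboolP.
by apply/eqP; rewrite eqmodE; apply/asboolP.
Qed.

Lemma coset_repr (a : quotientGroup) : coset_proj (repr a) = a.
Proof. exact: reprK. Qed.

Definition quot_mul (a b : quotientGroup) := coset_proj (repr a * repr b).
Definition quot_inv (a : quotientGroup) := coset_proj (repr a)^-1.

Lemma coset_projM x y : coset_proj (x * y) = quot_mul (coset_proj x) (coset_proj y).
Proof.
apply/coset_projP; set x' := repr _; set y' := repr _.
have /coset_projP Nx : coset_proj x = coset_proj x' by rewrite coset_repr.
have /coset_projP Ny : coset_proj y = coset_proj y' by rewrite coset_repr.
suff -> : (x * y)^-1 * (x' * y') = (x^-1 * x') ^ y * (y^-1 * y').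
  by apply: nsgM => //; exact: nsg_conj.
by rewrite /conjg invgM -!mulgA mulVKg.
Qed.

Lemma coset_projV x : coset_proj x^-1 = quot_inv (coset_proj x).
Proof.
apply/coset_projP; set x' := repr _.
have /coset_projP/nsgV Nx : coset_proj x = coset_proj x' by rewrite coset_repr.
have := nsg_conj x'^-1 Nx.
by rewrite /conjg invgM !invgK -!mulgA mulVKg.
Qed.

Let quot_mulA : associative quot_mul.
Proof.
move=> a b c; rewrite -(coset_repr a) -(coset_repr b) -(coset_repr c).
by rewrite -!coset_projM mulgA.
Qed.

Let quot_mul1 : left_id (coset_proj 1) quot_mul.
Proof. by move=> a; rewrite -(coset_repr a) -coset_projM mul1g. Qed.

Let quot_mulr1 : right_id (coset_proj 1) quot_mul.
Proof. by move=> a; rewrite -(coset_repr a) -coset_projM mulg1. Qed.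

Let quot_mulV : left_inverse (coset_proj 1) quot_inv quot_mul.
Proof.
by move=> a; rewrite -(coset_repr a) -coset_projV -coset_projM mulVg.
Qed.

Let quot_mulrV : right_inverse (coset_proj 1) quot_inv quot_mul.
Proof.
by move=> a; rewrite -(coset_repr a) -coset_projV -coset_projM mulgV.
Qed.

HB.instance Definition _ := isGroup.Build quotientGroup
  quot_mulA quot_mul1 quot_mulr1 quot_mulV quot_mulrV.

End Quotient.

Definition finite_index (G : groupType) (N : normalSubgroup G) :=
  finite_set [set: quotientGroup N].

Section Words.
Variables (G : groupType) (S : set G).
Local Open Scope group_scope.

Definition is_word (w : seq G) := {in w, forall s, S s \/ S s^-1}.

Definition generates := forall x : G,
  exists w, is_word w /\ \prod_(s <- w) s = x.

Definition has_word (x : G) : pred nat := fun k =>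
  `[< exists w, [/\ is_word w, size w = k & \prod_(s <- w) s = x] >].

Hypothesis genS : generates.

Fact word_exists (x : G) : exists k, has_word x k.
Proof.
by have [w [Sw wx]] := genS x; exists (size w); apply/asboolP; exists w.
Qed.

Definition word_length (x : G) : nat := ex_minn (word_exists x).

Lemma word_length_min w x :
  is_word w -> \prod_(s <- w) s = x -> (word_length x <= size w)%N.
Proof.
move=> Sw wx; rewrite /word_length; case: ex_minnP => m _; apply.
by apply/asboolP; exists w.
Qed.

Lemma word_lengthP x :
  exists w, [/\ is_word w, size w = word_length x & \prod_(s <- w) s = x].
Proof. by rewrite /word_length; case: ex_minnP => m /asboolP. Qed.

Lemma word_length1 : word_length 1 = 0%N.
Proof. by apply/eqP; rewrite -leqn0 (@word_length_min [::]) ?big_nil. Qed.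

Lemma word_length_eq0 x : word_length x = 0%N -> x = 1.
Proof.
move=> x0; have [w [_ + <-]] := word_lengthP x.
by rewrite x0 => /size0nil ->; rewrite big_nil.
Qed.

Lemma word_lengthM x y : (word_length (x * y) <= word_length x + word_length y)%N.
Proof.
have [v [Sv <- vx]] := word_lengthP x; have [w [Sw <- wy]] := word_lengthP y.
rewrite -size_cat word_length_min ?big_cat ?vx ?wy //= => s.
by rewrite mem_cat => /orP[/Sv|/Sw].
Qed.

Lemma word_lengthV x : (word_length x^-1 <= word_length x)%N.
Proof.
have [w [Sw <- wx]] := word_lengthP x.
rewrite -(size_map (fun s => s^-1) w) -size_rev word_length_min // => [s|].
  rewrite mem_rev => /mapP[t /Sw tS ->]; rewrite invgK.
  by case: tS; [right|left].
rewrite -{}wx {Sw}; elim: w => [|t w IHw]; first by rewrite !big_nil invg1.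
by rewrite big_cons invgM -IHw /= rev_cons -cats1 big_cat big_seq1.
Qed.

End Words.

(** The Cayley graph, represented by the set of its vertices with the word metric.  [R] is
    a phantom argument: it is the type of the values of the distance. *)
Definition cayley (R : realType) (G : groupType) (S : set G)
  (genS : generates S) : Type := G.

Section CayleyMetric.
Variables (R : realType) (G : groupType) (S : set G) (genS : generates S).
Local Notation cay := (cayley R genS).

HB.instance Definition _ := Choice.copy cay G.

Definition word_dist (x y : cay) : R :=
  (word_length genS ((x : G)^-1 * (y : G))%g)%:R.

Let word_distxx x : word_dist x x = 0.
Proof. by rewrite /word_dist mulVg word_length1. Qed.

Let word_dist_eq0 x y : word_dist x y = 0 -> x = y.
Proof.
move=> /eqP; rewrite pnatr_eq0 => /eqP/word_length_eq0 xy1.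
by rewrite -[x]mulg1 -xy1 mulVKg.
Qed.

Let word_dist_sym x y : word_dist x y = word_dist y x.
Proof.
by congr (_%:R); apply/eqP; rewrite eqn_leq; apply/andP; split;
  rewrite -[X in (X <= _)%N]/(word_length _ _) -[X in word_length _ X]invgK
    invgM invgK; exact: word_lengthV.
Qed.

Let word_dist_triangle y x z : word_dist x z <= word_dist x y + word_dist y z.
Proof.
rewrite /word_dist -natrD ler_nat; apply: leq_trans (word_lengthM _ _ _).
by rewrite mulgA mulgK.
Qed.

HB.instance Definition _ := isMetric.Build R cay
  word_distxx word_dist_eq0 word_dist_sym word_dist_triangle.

End CayleyMetric.

Lemma generates_quotient (G : groupType) (S : set G) (N : normalSubgroup G) :
  generates S -> generates (@coset_proj G N @` S).
Proof.
move=> genS a; have [w [Sw wa]] := genS (repr a).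
exists (map (@coset_proj G N) w); split=> [_ /mapP[s /Sw sS ->]|].
  by case: sS => sS; [left; exists s | right; exists s^-1%g; rewrite // coset_projV].
rewrite -[RHS]coset_repr -wa big_map {Sw wa}.
elim: w => [|s w IHw]; first by rewrite !big_nil.
by rewrite !big_cons IHw coset_projM.
Qed.

Definition box_space (R : realType) (G : groupType) (S : set G)
    (genS : generates S) (N : nat -> normalSubgroup G) (n : nat) : metricType R :=
  cayley R (@generates_quotient G S (N n) genS).

(** Functions on [0, +oo[ are represented by functions on [R], whose values at
    negative arguments are irrelevant. *)
Definition proper_halfline (R : realType) (f : R -> R) :=
  (forall t, 0 <= t -> 0 <= f t) /\
  (forall B : set R, bounded_set B -> bounded_set [set t | 0 <= t /\ B (f t)]).

Definition coarse_embedding (R : realType) (X : nat -> metricType R)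
    (Y : normedModType R) (phi : forall n, X n -> Y) :=
  exists rho gamma : R -> R,
    [/\ proper_halfline rho, proper_halfline gamma &
      forall n (x y : X n),
        rho (mdist x y) <= `|phi n x - phi n y| <= gamma (mdist x y)].

Definition coarsely_embeds (R : realType) (X : nat -> metricType R)
    (Y : normedModType R) :=
  exists phi : forall n, X n -> Y, coarse_embedding phi.

(** Real Hilbert spaces: positivity and completeness come with [{dot _ for _}]
    and [completeNormedModType]. *)
Record hilbertType (R : realType) := HilbertType {
  hilbert_sort :> completeNormedModType R;
  hdot : {dot hilbert_sort for idfun};
  hdot_norm : forall v, `|v| ^+ 2 = hdot v v }.

Definition orthogonal_rep (R : realType) (G : groupType) (V : hilbertType R)
    (pi : G -> {linear V -> V}) :=
  [/\ forall v, pi 1%g v = v,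
      forall g h v, pi (g * h)%g v = pi g (pi h v) &
      forall g v w, hdot V (pi g v) (pi g w) = hdot V v w].

Definition relative_property_T (R : realType) (G : groupType) (H : set G) :=
  forall (V : hilbertType R) (pi : G -> {linear V -> V}),
    orthogonal_rep pi ->
    forall v : nat -> V, (forall n, `|v n| = 1) ->
    (forall g, `|pi g (v n) - v n| @[n --> \oo] --> (0 : R)) ->
    sup [set `|pi h (v n) - v n| | h in H] @[n --> \oo] --> (0 : R).

Section Bochner.
Context {d : measure_display} {W : measurableType d} {R : realType}.
Variable mu : {measure set W -> \bar R}.

Definition simple_function (X : Type) (s : W -> X) :=
  finite_set (range s) /\ forall x, measurable (s @^-1` [set x]).

Definition strongly_measurable (X : normedModType R) (F : W -> X) :=
  exists s : nat -> W -> X,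
    (forall n, simple_function (s n)) /\
    (forall w, s n w @[n --> \oo] --> F w).

(** Representatives of the elements of L^2(W, mu, X); two of them define the
    same element when they are equal almost everywhere. *)
Definition bochner_L2 (X : normedModType R) : set (W -> X) :=
  [set F | strongly_measurable F /\ (fun w => `|F w|) \in Lfun mu 2%:E].

Definition scalar_L2 : set (W -> R) := [set f | f \in Lfun mu 2%:E].

(** [T] induces a linear map from [E] modulo almost everywhere equality to
    itself. *)
Definition ae_linear_operator (V : lmodType R) (E : set (W -> V))
    (T : (W -> V) -> (W -> V)) :=
  [/\ forall f, E f -> E (T f),
      forall f g, E f -> E g -> f = g %[ae mu] -> T f = T g %[ae mu] &
      forall (a : R) f g, E f -> E g ->
        T (fun w => a *: f w + g w) = (fun w => a *: T f w + T g w) %[ae mu]].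

(** For [p] distinct from 2, this is a bound for the restriction of [T] to the
    elements of L^2 that are in L^p. *)
Definition scalar_opnorm_le (p : \bar R) (C : R) (T : (W -> R) -> (W -> R)) :=
  forall f, scalar_L2 f -> f \in Lfun mu p ->
    ('N[mu]_p[EFin \o T f] <= C%:E * 'N[mu]_p[EFin \o f])%E.

Definition bochner_opnorm_le (X : normedModType R) (C : R)
    (T : (W -> X) -> (W -> X)) :=
  forall F, bochner_L2 F ->
    ('N[mu]_2%:E[EFin \o (fun w => `|T F w|%R)] <=
       C%:E * 'N[mu]_2%:E[EFin \o (fun w => `|F w|%R)])%E.

(** [TX] is the operator [T (x) id_X] on L^2(W, mu, X). *)
Definition tensor_extension (X : normedModType R)
    (T : (W -> R) -> (W -> R)) (TX : (W -> X) -> (W -> X)) :=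
  ae_linear_operator (@bochner_L2 X) TX /\
  forall f (x : X), scalar_L2 f ->
    TX (fun w => f w *: x) = (fun w => T f w *: x) %[ae mu].

End Bochner.

Definition uniformly_curved (R : realType) (X : completeNormedModType R) :=
  exists Delta : R -> R,
    Delta eps @[eps --> 0^'+] --> (0 : R) /\
    forall eps : R, 0 < eps ->
    forall (d : measure_display) (W : measurableType d)
      (mu : {measure set W -> \bar R}) (T : (W -> R) -> (W -> R)),
      ae_linear_operator mu (V := R^o) (scalar_L2 mu) T ->
      scalar_opnorm_le mu 2%:E eps T ->
      scalar_opnorm_le mu 1%:E 1 T ->
      scalar_opnorm_le mu +oo%E 1 T ->
      exists TX : (W -> X) -> (W -> X),
        tensor_extension mu T TX /\ bochner_opnorm_le mu (Delta eps) TX.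

(* Main.v *)
Require Import Defs.
From HB Require Import structures.
From mathcomp Require Import all_boot all_order all_algebra finmap.
From mathcomp Require Import all_classical all_reals all_analysis ess_sup_inf.
From mathcomp Require Import ring lra.

Set Implicit Arguments.
Unset Strict Implicit.
Unset Printing Implicit Defensive.

Import Order.TTheory GRing.Theory Num.Theory.
Import numFieldNormedType.Exports.

Local Open Scope classical_set_scope.
Local Open Scope ring_scope.

(** Write [Q_n = G / N_n], and for functions on [Q_n] let [A] be the mean of the
    right translations by a finite list containing [1] and [S], and [P] the mean of
    the right translations by the image [H_n] of [H].  Right translations by
    generators move each point by at most [1] in the word metric, which is invariant
    on the left.

    Relative property (T) gives a spectral gap that is uniform in [n]: for some
    [lambda < 1], [|A v|^2 <= lambda |v|^2] for all real functions [v] on [Q_n] with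
    [P v = 0] ([spectral_gap]).  Otherwise there would be unit vectors [v_j] with
    [P v_j = 0] and [|A v_j|] tending to [1].  By strict convexity of the Hilbert
    norm these are almost invariant under [S], hence under each element of [G]
    ([displacement_le], [almost_invariant]).  They all sit in one orthogonal
    representation, on a Hilbert sum of the spaces of functions on the [Q_(n_j)], so
    they are almost invariant uniformly over [H]; but a unit vector whose translates
    under [H_n] are all close to it cannot have mean zero ([mean0_displaced]).

    As [H] is normal, [P] commutes with [A], so that [A^k] has square norm at most
    [lambda^k] on the kernel of [P].  Hence [T = (A^k - A^k P) / 2], which is a
    contraction for the L^1 and L^oo norms, has arbitrarily small L^2 norm when [k]
    is large.  Uniform curvature, applied to the finite set [Q_n] with its counting
    measure ([uniformly_curved_finite]), makes the norm of [T] on functions with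
    values in [X] at most 1/4, with [k] independent of [n].

    Let [F : Q_n -> X] be part of a coarse embedding and [g = F - P F].  Then [A^k g]
    has at most half the norm of [g], whereas [g - A^k g] is bounded pointwise, since
    [F] moves by a bounded amount along edges.  So the mean square of [|g|] is
    bounded independently of [n], and for each [h] in [H_n] some point [x] has
    [F x] and [F (x h)] within a bounded distance ([close_pair]).  By properness of
    [rho] the word length of [h], which is the distance from [x] to [x h], is
    bounded independently of [n] and [h].  Every element of [H] is then congruent
    modulo each [N_n] to an element of a fixed finite ball of [G]; as the [N_n]
    decrease to the trivial group, [H] is contained in that ball ([separated_mem]),
    and [H] is infinite. *)

(** * Sums of nonnegative families *)
Section NonnegativeSums.
Variables (R : realType) (I : choiceType).
Implicit Types a b : I -> R.

Definition nnsum a : \bar R := \esum_(i in [set: I]) (a i)%:E.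

Lemma nnsum_ge0 a : (forall i, 0 <= a i) -> (0 <= nnsum a)%E.
Proof. by move=> a0; apply: esum_ge0 => i _; rewrite lee_fin. Qed.

Lemma le_nnsum a b : (forall i, a i <= b i) -> (nnsum a <= nnsum b)%E.
Proof. by move=> ab; apply: le_esum => i _; rewrite lee_fin. Qed.

Lemma nnsumD a b : (forall i, 0 <= a i) -> (forall i, 0 <= b i) ->
  nnsum (fun i => a i + b i) = (nnsum a + nnsum b)%E.
Proof.
move=> a0 b0; rewrite /nnsum -esumD; first by apply: eq_esum => i _; rewrite EFinD.
- by move=> i _; rewrite lee_fin.
- by move=> i _; rewrite lee_fin.
Qed.

Lemma nnsum_le a M :
  (forall A : set I, finite_set A -> \sum_(i \in A) a i <= M) ->
  (nnsum a <= M%:E)%E.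
Proof.
move=> aM; apply: ge_ereal_sup => _ [A [finA _] <-].
by rewrite fsumEFin // lee_fin; exact: aM.
Qed.

Lemma nnsum_ubound a (A : set I) : finite_set A ->
  ((\sum_(i \in A) a i)%:E <= nnsum a)%E.
Proof.
move=> finA; rewrite -fsumEFin //; apply: ereal_sup_ubound.
by exists A.
Qed.

(** The inequality from left to right holds for each finite partial sum; applied to
    [c^-1] and [c a], it gives the converse. *)
Lemma nnsumZ c a : 0 <= c -> (forall i, 0 <= a i) ->
  nnsum (fun i => c * a i) = (c%:E * nnsum a)%E.
Proof.
have le c' b : 0 <= c' -> (forall i, 0 <= b i) ->
    (nnsum (fun i => c' * b i)%R <= c'%:E * nnsum b)%E.
  move=> c0 b0; apply: ge_ereal_sup => _ [A [finA _] <-].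
  rewrite fsumEFin // -mulr_fsumr EFinM; apply: lee_wpmul2l; rewrite ?lee_fin //.
  exact: nnsum_ubound.
move=> c0 a0; apply/eqP; rewrite eq_le le //=.
have /orP[/eqP c0'|{}c0] : (0 == c) || (0 < c) by rewrite -le_eqVlt.
  by rewrite -c0' mul0e nnsum_ge0 // => i; rewrite mul0r.
have := @le c^-1 (fun i => c * a i).
rewrite invr_ge0 ltW // => /(_ isT) h.
have {h} : (nnsum a <= (c^-1)%:E * nnsum (fun i => (c * a i)%R))%E.
  apply: le_trans (h _); last by move=> i; rewrite mulr_ge0 // ltW.
  by apply: le_nnsum => i; rewrite mulrA mulVf ?mul1r // gt_eqF.
by rewrite lee_pdivlMl.
Qed.

Lemma nnsum_reindex (e : I -> I) a : bijective e ->
  nnsum (fun i => a (e i)) = nnsum a.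
Proof.
move=> [f ef fe]; rewrite /nnsum.
rewrite (reindex_esum [set: I] [set: I] e (fun i => (a i)%:E)) //.
split=> //; first by move=> x y _ _; exact: (can_inj ef).
by move=> y _; exists (f y).
Qed.

Lemma nnsum_support (D : set I) a : finite_set D -> (forall i, 0 <= a i) ->
  (forall i, ~ D i -> a i = 0) -> nnsum a = (\sum_(i \in D) a i)%:E.
Proof.
move=> finD a0 aD; apply/eqP; rewrite eq_le nnsum_ubound // andbT.
apply: nnsum_le => A finA; rewrite -lee_fin -!fsumEFin //.
have finU : finite_set (A `|` D) by rewrite finite_setU.
rewrite [leRHS](@fsbig_widen _ _ 0%E +%E D (A `|` D)).
- apply: lee_fsum_nneg_subset => //; first exact/subsetP/subsetUl.
  by move=> i _; rewrite lee_fin.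
- exact: subsetUr.
- by move=> i [_ /= Di]; rewrite aD.
Qed.

End NonnegativeSums.

(** * The Hilbert space of square-summable families *)
Section SquareSummable.
Variables (R : realType) (I : choiceType).
Implicit Types f g : I -> R^o.

Definition sqsum f : \bar R := nnsum (fun i => f i ^+ 2).

Definition square_summable : {pred I -> R^o} :=
  [pred f | (sqsum f < +oo)%E].

Lemma sqsum_ge0 f : (0 <= sqsum f)%E.
Proof. by apply: nnsum_ge0 => i; rewrite sqr_ge0. Qed.

Lemma sqsumZ a f : sqsum (a *: f) = ((a ^+ 2)%:E * sqsum f)%E.
Proof.
rewrite -nnsumZ ?sqr_ge0 // => [|i]; last exact: sqr_ge0.
by congr nnsum; apply/funext => i; rewrite -exprMn.
Qed.

(** Weighted form of [(x + y)^2 <= 2 x^2 + 2 y^2]; optimizing over the weight [s]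
    gives the triangle inequality for the square root of [sqsum]. *)
Lemma sqsumD_le (s : R) f g : 0 < s ->
  (sqsum (f + g)%R <= (1 + s)%:E * sqsum f + (1 + s^-1)%:E * sqsum g)%E.
Proof.
move=> s0; have si0 : 0 < s^-1 by rewrite invr_gt0.
have sq0 h i : 0 <= h i ^+ 2 :> R by exact: sqr_ge0.
rewrite -!nnsumZ ?addr_ge0 // ?(ltW s0) ?(ltW si0) // -nnsumD.
- apply: le_nnsum => i; rewrite -subr_ge0.
  have -> : (1 + s) * f i ^+ 2 + (1 + s^-1) * g i ^+ 2 - (f + g) i ^+ 2 =
      s^-1 * (s * f i - g i) ^+ 2.
    rewrite -[(f + g) i]/(f i + g i); field; exact: lt0r_neq0.
  by rewrite mulr_ge0 ?sqr_ge0 // ltW.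
- by move=> i; rewrite mulr_ge0 ?sqr_ge0 ?addr_ge0 // ltW.
- by move=> i; rewrite mulr_ge0 ?sqr_ge0 ?addr_ge0 // ltW.
Qed.

Lemma square_summable_submod : submod_closed square_summable.
Proof.
split=> [|a f g]; rewrite !inE.
  rewrite /sqsum (_ : (fun _ => _) = cst 0); last first.
    by apply/funext => i; rewrite /= expr0n.
  by rewrite /nnsum esum1.
move=> fS gS; apply: (le_lt_trans (sqsumD_le (a *: f) g (@ltr01 R))).
rewrite lte_add_pinfty // lte_mul_pinfty ?lee_fin ?addr_ge0 ?invr_ge0 //.
by rewrite sqsumZ lte_mul_pinfty ?lee_fin ?sqr_ge0.
Qed.

HB.instance Definition _ :=
  GRing.isSubmodClosed.Build R (I -> R^o) square_summable square_summable_submod.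

Record ell2 := Ell2 { ell2_fun :> I -> R^o; ell2P : ell2_fun \in square_summable }.

HB.instance Definition _ := [isSub for ell2_fun].
HB.instance Definition _ := [Choice of ell2 by <:].
HB.instance Definition _ := [SubChoice_isSubLmodule of ell2 by <:].

Implicit Types u v w : ell2.

(** The square of the norm; the notation [`|u|] is available only once the triangle
    inequality is known. *)
Definition sqnorm u : R := fine (sqsum u).

Lemma sqnormE u : (sqnorm u)%:E = sqsum u.
Proof.
by rewrite /sqnorm fineK // ge0_fin_numE ?sqsum_ge0 //; case: u => f /=; rewrite inE.
Qed.

Lemma ell2DE u v i : (u + v) i = u i + v i. Proof. by []. Qed.
Lemma ell2ZE a u i : (a *: u) i = a * u i. Proof. by []. Qed.
Lemma ell20E i : (0 : ell2) i = 0. Proof. by []. Qed.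

Lemma ell2_ext u v : (forall i, u i = v i) -> u = v.
Proof. by move=> uv; apply/val_inj/funext. Qed.

Lemma sqnorm_ge0 u : 0 <= sqnorm u.
Proof. by rewrite -lee_fin sqnormE sqsum_ge0. Qed.

Lemma sqnormZ a u : sqnorm (a *: u) = a ^+ 2 * sqnorm u.
Proof. by apply: EFin_inj; rewrite EFinM !sqnormE -sqsumZ. Qed.

Lemma sqnorm_coord u i : u i ^+ 2 <= sqnorm u.
Proof.
by rewrite -lee_fin sqnormE; apply: le_trans (nnsum_ubound _ (finite_set1 i)); rewrite fsbig_set1.
Qed.

Lemma sqnorm_eq0 u : sqnorm u = 0 -> u = 0.
Proof.
move=> u0; apply: ell2_ext => i; apply/eqP; rewrite ell20E -sqrf_eq0.
by rewrite eq_le sqr_ge0 andbT -u0 sqnorm_coord.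
Qed.

Lemma sqnorm_triangle u v :
  Num.sqrt (sqnorm (u + v)) <= Num.sqrt (sqnorm u) + Num.sqrt (sqnorm v).
Proof.
have [u0|] := leP (sqnorm u) 0.
  have /sqnorm_eq0 -> : sqnorm u = 0 by apply/eqP; rewrite eq_le u0 sqnorm_ge0.
  by rewrite add0r ler_wpDl ?sqrtr_ge0.
rewrite -sqrtr_gt0; set a := Num.sqrt _ => a0.
have [v0|] := leP (sqnorm v) 0.
  have /sqnorm_eq0 -> : sqnorm v = 0 by apply/eqP; rewrite eq_le v0 sqnorm_ge0.
  by rewrite addr0 ler_wpDr ?sqrtr_ge0.
rewrite -sqrtr_gt0; set b := Num.sqrt _ => b0.
rewrite -(ler_pXn2r (isT : 0 < 2)%N) ?nnegrE ?sqrtr_ge0 ?addr_ge0 // ?(ltW a0) ?(ltW b0) //.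
rewrite sqr_sqrtr ?sqnorm_ge0 // -lee_fin sqnormE.
(* The weight [b / a] turns the bound into [(a + b) ^+ 2]. *)
apply: le_trans (sqsumD_le _ _ (divr_gt0 b0 a0)) _.
rewrite -!sqnormE -!EFinM -EFinD lee_fin -[sqnorm u]sqr_sqrtr ?sqnorm_ge0 //.
rewrite -[sqnorm v]sqr_sqrtr ?sqnorm_ge0 // -/a -/b.
rewrite le_eqVlt; apply/orP; left; apply/eqP; field.
by rewrite !lt0r_neq0.
Qed.

Let norm u := Num.sqrt (sqnorm u).

Let normZ (a : R) u : norm (a *: u) = `|a| * norm u.
Proof. by rewrite /norm sqnormZ sqrtrM ?sqr_ge0 // sqrtr_sqr. Qed.

Let norm0_eq0 u : norm u = 0 -> u = 0.
Proof.
move=> /eqP; rewrite sqrtr_eq0 => u0; apply: sqnorm_eq0.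
by apply/eqP; rewrite eq_le u0 sqnorm_ge0.
Qed.

HB.instance Definition _ :=
  Lmodule_isNormed.Build R ell2 sqnorm_triangle normZ norm0_eq0.

Lemma ell2_norm u : `|u| ^+ 2 = sqnorm u.
Proof. exact: (sqr_sqrtr (sqnorm_ge0 u)). Qed.

End SquareSummable.

Section HilbertSpace.
Variables (R : realType) (I : choiceType).
Local Notation ell2 := (ell2 R I).
Implicit Types u v w : ell2.

(** Linear identities between squared norms with nonnegative weights can be checked
    coordinatewise: both sides are sums of nonnegative families, where no question of
    convergence arises. *)
Lemma sqnorm_combine (p q r t : R) u1 u2 u3 u4 :
  0 <= p -> 0 <= q -> 0 <= r -> 0 <= t ->
  (p * sqnorm u1 + q * sqnorm u2 + r * sqnorm u3 + t * sqnorm u4)%:E =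
  nnsum (fun i => p * u1 i ^+ 2 + q * u2 i ^+ 2 + r * u3 i ^+ 2 + t * u4 i ^+ 2).
Proof.
move=> p0 q0 r0 t0.
have sq0 u i : 0 <= u i ^+ 2 :> R by exact: sqr_ge0.
have wsq0 (c : R) u : 0 <= c -> forall i, 0 <= c * u i ^+ 2.
  by move=> c0 i; rewrite mulr_ge0.
rewrite 3?nnsumD; try by move=> i; rewrite ?addr_ge0 ?wsq0.
by rewrite 4?nnsumZ // !EFinD !EFinM !sqnormE.
Qed.

(** Polarization gives the inner product without summing products of arbitrary
    sign; bilinearity reduces to [sqnorm_combine]. *)
Definition ell2_dot u v : R := (sqnorm (u + v) - sqnorm u - sqnorm v) / 2.

Lemma ell2_dotC u v : ell2_dot u v = ell2_dot v u.
Proof. by rewrite /ell2_dot [u + v]addrC addrAC. Qed.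

Lemma ell2_dot_diag u : ell2_dot u u = sqnorm u.
Proof.
rewrite /ell2_dot; have -> : u + u = 2 *: u by rewrite scaler_nat.
by rewrite sqnormZ; field.
Qed.

(** Splitting on the sign of [a] keeps all the weights nonnegative, so that the
    identity follows from [sqnorm_combine]. *)
Lemma ell2_dot_linearl a u u' v :
  ell2_dot (a *: u + u') v = a * ell2_dot u v + ell2_dot u' v.
Proof.
have [a0|/ltW a0] := leP 0 a.
  have : (1 * sqnorm (a *: u + u' + v) + a * sqnorm u + a * sqnorm v + 1 * sqnorm u')%:E =
      (1 * sqnorm (a *: u + u') + a * sqnorm (u + v) + 1 * sqnorm (u' + v) +
         0 * sqnorm (0 : ell2))%:E.
    rewrite !sqnorm_combine ?ler01 ?lexx //.
    congr nnsum; apply/funext => i.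
    by rewrite !(ell2DE, ell2ZE, ell20E); ring.
  move=> e; move: (EFin_inj e) => {e}; rewrite /ell2_dot.
  move: (sqnorm (a *: u + u' + v)) (sqnorm (a *: u + u')) (sqnorm (u + v)) (sqnorm (u' + v)).
  by move: (sqnorm u) (sqnorm v) (sqnorm u') (sqnorm 0) => *; lra.
rewrite -oppr_ge0 in a0.
have : (1 * sqnorm (a *: u + u' + v) + - a * sqnorm (u + v) + 1 * sqnorm u' +
      0 * sqnorm (0 : ell2))%:E =
    (1 * sqnorm (a *: u + u') + - a * sqnorm u + - a * sqnorm v + 1 * sqnorm (u' + v))%:E.
  rewrite !sqnorm_combine ?ler01 ?lexx //.
  congr nnsum; apply/funext => i.
  by rewrite !(ell2DE, ell2ZE, ell20E); ring.
move=> e; move: (EFin_inj e) => {e}; rewrite /ell2_dot.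
move: (sqnorm (a *: u + u' + v)) (sqnorm (a *: u + u')) (sqnorm (u + v)) (sqnorm (u' + v)).
by move: (sqnorm u) (sqnorm v) (sqnorm u') (sqnorm 0) => *; lra.
Qed.

Let ell2_dot_bilinear : bilinear_for *%R (idfun \; *%R) ell2_dot.
Proof.
split=> u a v w; first exact: ell2_dot_linearl.
by rewrite ell2_dotC ell2_dot_linearl ![ell2_dot _ u]ell2_dotC.
Qed.

HB.instance Definition _ :=
  bilinear_isBilinear.Build R ell2 ell2 R *%R (idfun \; *%R) ell2_dot ell2_dot_bilinear.

Let ell2_dot_hermitian u v : ell2_dot u v = (-1) ^+ false * idfun (ell2_dot v u).
Proof. by rewrite expr0 mul1r ell2_dotC. Qed.

HB.instance Definition _ :=
  isHermitianSesquilinear.Build R ell2 false idfun ell2_dot ell2_dot_hermitian.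

Let ell2_dot_gt0 u : u != 0 -> 0 < ell2_dot u u.
Proof.
move=> u0; rewrite ell2_dot_diag lt_neqAle sqnorm_ge0 andbT.
by apply: contra_neq u0 => /esym/sqnorm_eq0.
Qed.

HB.instance Definition _ := isDotProduct.Build R ell2 ell2_dot ell2_dot_gt0.

Lemma ell2_coord_le u i : `|u i| <= `|u|.
Proof.
rewrite -(ler_pXn2r (isT : 0 < 2)%N) ?nnegrE // ell2_norm.
by rewrite real_normK ?num_real // sqnorm_coord.
Qed.

Lemma ell2_norm_le (u : ell2) (M : R) : 0 <= M ->
  (forall A : set I, finite_set A -> \sum_(i \in A) u i ^+ 2 <= M ^+ 2) -> `|u| <= M.
Proof.
move=> M0 uM; rewrite -(ler_pXn2r (isT : 0 < 2)%N) ?nnegrE // ell2_norm.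
by rewrite -lee_fin sqnormE; exact: nnsum_le.
Qed.

(** The limit is taken coordinatewise.  A bound on [`|u - v|] for [v] near [F] passes
    to the limit in each finite partial sum, hence to [u] minus the limit. *)
Lemma ell2_cauchy_cvg (F : set_system ell2) : ProperFilter F -> cauchy F -> cvg F.
Proof.
move=> FF Fc.
have Fc' (e : R) : 0 < e -> exists u : ell2, \forall v \near F, `|u - v| < e.
  by move=> e0; have [u Fu] := (cauchyP _).1 Fc e e0; exists u; exact: Fu.
have cvgi i : cvg ((fun u : ell2 => u i : R) @ F).
  apply: cauchy_cvg; apply/cauchy_exP => e e0.
  have [u Fu] := Fc' e e0; exists (u i).
  apply: filterS Fu => v uv /=; rewrite /ball /=.
  by apply: le_lt_trans uv; exact: (ell2_coord_le (u - v) i).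
pose l i := lim ((fun u : ell2 => u i : R) @ F).
have cvgseq u (s : seq I) :
    (fun v : ell2 => \sum_(i <- s) (u i - v i) ^+ 2) @ F --> \sum_(i <- s) (u i - l i) ^+ 2.
  elim: s => [|i s IHs].
    rewrite big_nil (_ : (fun v => _) = fun=> 0); first exact: cvg_cst.
    by apply/funext => v; rewrite big_nil.
  rewrite big_cons (_ : (fun v => _) =
    fun v : ell2 => (u i - v i) ^+ 2 + \sum_(j <- s) (u j - v j) ^+ 2); last first.
    by apply/funext => v; rewrite big_cons.
  apply: cvgD IHs; have ui : (fun v : ell2 => u i - v i) @ F --> u i - l i.
    by apply: cvgB; [exact: cvg_cst|exact: cvgi].
  exact: (cvgM ui ui).
have cvgsum u (A : set I) : finite_set A ->
    (fun v : ell2 => \sum_(i \in A) (u i - v i) ^+ 2) @ F --> \sum_(i \in A) (u i - l i) ^+ 2.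
  move=> finA; rewrite (fsbig_finite _ _ finA) (_ : (fun v => _) =
    fun v : ell2 => \sum_(i <- finmap.enum_fset (fset_set A)) (u i - v i) ^+ 2) //.
  by apply/funext => v; rewrite (fsbig_finite _ _ finA).
have near_l u (e : R) : 0 < e -> (\forall v \near F, `|u - v| < e) ->
    forall A : set I, finite_set A -> \sum_(i \in A) (u i - l i) ^+ 2 <= e ^+ 2.
  move=> e0 Fu A finA; apply: (cvgr_to_le (cvgsum u A finA)).
  apply: filterS Fu => v /ltW uv.
  have : `|u - v| ^+ 2 <= e ^+ 2.
    by rewrite ler_pXn2r ?nnegrE // ltW.
  apply: le_trans; rewrite ell2_norm -lee_fin sqnormE.
  exact: (nnsum_ubound (fun i => (u - v) i ^+ 2) finA).
have lS : (l : I -> R^o) \in @square_summable R I.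
  have [u Fu] := Fc' 1 ltr01.
  have ulS : ((u : I -> R^o) - l) \in @square_summable R I.
    rewrite inE /sqsum; apply: (@le_lt_trans _ _ (1 ^+ 2)%:E); rewrite ?ltry //.
    by apply: nnsum_le; exact: near_l Fu.
  have -> : l = (u : I -> R^o) - ((u : I -> R^o) - l) by rewrite opprB addrC subrK.
  by rewrite rpredB // ell2P.
apply/cvg_ex; exists (Ell2 lS); apply/cvgrPdist_le => e e0.
have [u Fu] := Fc' (e / 2) (divr_gt0 e0 (ltr0Sn _ 1)).
have ul : `|u - Ell2 lS| <= e / 2.
  by apply: ell2_norm_le; [rewrite divr_ge0 // ltW|apply: near_l Fu; rewrite divr_gt0].
apply: filterS Fu => v uv.
rewrite -(subrKA u); apply: le_trans (ler_normD _ _) _.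
by rewrite distrC; lra.
Qed.

HB.instance Definition _ := Uniform_isComplete.Build ell2 ell2_cauchy_cvg.

Definition ell2_hilbert : hilbertType R :=
  @HilbertType R ell2 ell2_dot (fun u => etrans (ell2_norm u) (esym (ell2_dot_diag u))).

End HilbertSpace.

(** * Averages of translates on a finite group *)
Section Elements.
Variable T : choiceType.
Implicit Types A : set T.

Definition elts A : seq T := enum_fset (fset_set A).

Lemma uniq_elts A : uniq (elts A).
Proof. exact: fset_uniq. Qed.

Lemma eltsP A x : finite_set A -> reflect (A x) (x \in elts A).
Proof.
move=> finA; rewrite /elts -[_ \in _]/(x \in fset_set A) in_fset_set //.
by apply: (iffP idP); rewrite inE.
Qed.

Lemma elts_mapE A (f : T -> T) : finite_set A -> injective f ->
  (forall x, A x -> A (f x)) -> perm_eq (map f (elts A)) (elts A).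
Proof.
move=> finA injf fA.
have Uf : uniq (map f (elts A)) by rewrite map_inj_uniq ?uniq_elts.
apply: uniq_perm => //; first exact: uniq_elts.
have fsub : {subset map f (elts A) <= elts A}.
  by move=> _ /mapP[x /(eltsP _ finA) Ax ->]; apply/eltsP => //; exact: fA.
by case: (uniq_min_size Uf fsub); rewrite ?size_map.
Qed.

Lemma sum_elts_reindex (V : nmodType) A (f : T -> T) (F : T -> V) :
  finite_set A -> injective f -> (forall x, A x -> A (f x)) ->
  \sum_(x <- elts A) F (f x) = \sum_(x <- elts A) F x.
Proof.
move=> finA injf fA.
rewrite -(big_map f xpredT F); exact/perm_big/elts_mapE.
Qed.

End Elements.

Section Average.
Variables (R : realType) (Q : groupType) (V : normedModType R).
Implicit Types (l : seq Q) (f g : Q -> V) (x y : Q).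

Definition average l f x : V :=
  (size l)%:R^-1 *: \sum_(s <- l) f (x * s)%g.

Lemma average_linear l a f g x :
  average l (fun y => a *: f y + g y) x = a *: average l f x + average l g x.
Proof.
rewrite /average big_split /= scalerDr -scaler_sumr !scalerA.
by rewrite [_ * a]mulrC.
Qed.

Lemma averageB l f g x :
  average l (fun y => f y - g y) x = average l f x - average l g x.
Proof.
rewrite (_ : (fun y => _) = fun y => -1 *: g y + f y); last first.
  by apply/funext => y; rewrite scaleN1r addrC.
by rewrite average_linear scaleN1r addrC.
Qed.

Lemma average_eq l f (v : V) x : (0 < size l)%N ->
  (forall s, s \in l -> f (x * s)%g = v) -> average l f x = v.
Proof.
move=> l0 fv; rewrite /average (eq_big_seq (fun=> v)) // big_const_seq count_predT.
by rewrite iter_addr_0 -[v *+ _]scaler_nat scalerA mulVf ?scale1r // pnatr_eq0 -lt0n.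
Qed.

Lemma average_dist_le l f (c : R) x : (0 < size l)%N ->
  (forall s, s \in l -> `|f x - f (x * s)%g| <= c) -> `|f x - average l f x| <= c.
Proof.
move=> l0 fc; rewrite -[f x](@average_eq l (fun=> f x) (f x) x) // -averageB.
rewrite /average normrZ ger0_norm ?invr_ge0 ?ler0n //.
rewrite ler_pdivrMl ?ltr0n //.
apply: le_trans (ler_norm_sum _ _ _) _.
rewrite big_seq; apply: le_trans (ler_sum _ fc) _.
by rewrite -big_seq big_const_seq count_predT iter_addr_0 mulr_natl.
Qed.

(** Moving [s] across [h] in [f (x * h * s)] replaces [h] by its conjugate [h ^ s],
    which only permutes the conjugation-invariant set [A]. *)
Lemma average_comm (A : set Q) l f x : finite_set A ->
  (forall y z, A y -> A (y ^ z)%g) ->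
  average (elts A) (average l f) x = average l (average (elts A) f) x.
Proof.
move=> finA nA; rewrite /average -!scaler_sumr !scalerA [_ * (size l)%:R^-1]mulrC.
congr (_ *: _); rewrite exchange_big /=; apply: eq_bigr => s _.
rewrite -[RHS](@sum_elts_reindex _ _ A (fun h => h ^ s)%g) //.
- by apply: eq_bigr => h _; rewrite -!mulgA [(h * s)%g]conjgC.
- exact: (can_inj (conjgK s)).
- by move=> h; exact: nA.
Qed.

Lemma average_invariant (A : set Q) f h x : finite_set A ->
  (forall y z, A y -> A z -> A (y * z)%g) -> A h ->
  average (elts A) f (x * h)%g = average (elts A) f x.
Proof.
move=> finA mulA Ah; rewrite /average; congr (_ *: _).
rewrite -[RHS](@sum_elts_reindex _ _ A (fun y => h * y)%g) //.
- by apply: eq_bigr => y _; rewrite mulgA.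
- exact: mulgI.
- by move=> y; exact: mulA.
Qed.

Lemma average_defect (A : set Q) f x : finite_set A -> A 1%g ->
  (forall y z, A y -> A z -> A (y * z)%g) ->
  average (elts A) (fun y => f y - average (elts A) f y) x = 0.
Proof.
move=> finA A1 mulA; rewrite averageB.
apply/eqP; rewrite subr_eq0 eq_sym; apply/eqP; apply: average_eq => [|h].
  by rewrite lt0n size_eq0; apply/eqP => e0; have /(eltsP _ finA) := A1; rewrite e0.
by move=> /(eltsP _ finA) Ah; exact: average_invariant.
Qed.

End Average.

Section Contraction.
Variables (R : realType) (Q : groupType) (finQ : finite_set [set: Q]).
Variable V : normedModType R.
Implicit Types (l : seq Q) (f g : Q -> V) (x y : Q).

(** The mean of the squared deviations from the mean is the mean of the squares minus
    the square of the mean; the mean is held fixed at the point [x]. *)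
Lemma average_variance l (a : Q -> R^o) x : (0 < size l)%N ->
  average l (fun y => (a y - average l a x) ^+ 2 : R^o) x =
  average l (fun y => a y ^+ 2 : R^o) x - average l a x ^+ 2.
Proof.
move=> l0; set m := average l a x.
rewrite (_ : (fun y => _) =
    fun y => (- 2 * m) *: a y + (1 *: (a y ^+ 2 : R^o) + m ^+ 2)); last first.
  by apply/funext => y; rewrite /GRing.scale /=; ring.
rewrite !average_linear -/m (@average_eq _ _ R^o l (fun=> m ^+ 2) (m ^+ 2)) //.
by rewrite /GRing.scale /=; ring.
Qed.

Lemma average_ge0 l (a : Q -> R^o) x : (forall y, 0 <= a y) -> 0 <= average l a x.
Proof. by move=> a0; rewrite mulr_ge0 ?invr_ge0 ?ler0n ?sumr_ge0. Qed.

Lemma sum_translate (W : nmodType) (F : Q -> W) y :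
  \sum_(x <- elts [set: Q]) F (x * y)%g = \sum_(x <- elts [set: Q]) F x.
Proof. by apply: (@sum_elts_reindex _ W setT (fun x => x * y)%g) => //; exact: mulIg. Qed.

Lemma sum_average_le l (a : Q -> R) : (forall x, 0 <= a x) ->
  \sum_(x <- elts [set: Q]) average l (a : Q -> R^o) x <= \sum_(x <- elts [set: Q]) a x.
Proof.
move=> a0; rewrite /average -scaler_sumr exchange_big /=.
under eq_bigr do rewrite (sum_translate a).
have s0 : 0 <= \sum_(x <- elts [set: Q]) a x by rewrite sumr_ge0.
rewrite big_const_seq count_predT iter_addr_0; set t := \sum_(x <- _) _ in s0 *.
have [->|l0] := eqVneq (size l) 0%N; first by rewrite mulr0n scaler0.
by rewrite /GRing.scale /= -[t *+ _]mulr_natl mulrA mulVf ?mul1r // pnatr_eq0.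
Qed.

Lemma norm_average_le l f x :
  `|average l f x| <= average l (fun y => `|f y| : R^o) x.
Proof.
rewrite /average normrZ ger0_norm ?invr_ge0 ?ler0n //.
by rewrite ler_wpM2l ?invr_ge0 ?ler0n // ler_norm_sum.
Qed.

Lemma sqr_average_le l (a : Q -> R^o) x :
  average l a x ^+ 2 <= average l (fun y => a y ^+ 2 : R^o) x.
Proof.
have [l0|l0] := eqVneq (size l) 0%N.
  by rewrite /average l0 invr0 !scale0r expr0n.
by rewrite -subr_ge0 -average_variance ?lt0n // average_ge0 // => y; rewrite sqr_ge0.
Qed.

Definition l2sq f : R := \sum_(x <- elts [set: Q]) `|f x| ^+ 2.

Lemma l2sq_ge0 f : 0 <= l2sq f.
Proof. by apply: sumr_ge0 => x _; exact: sqr_ge0. Qed.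

Lemma l2sq_average_le l f : l2sq (average l f) <= l2sq f.
Proof.
apply: le_trans (@sum_average_le l (fun x => `|f x| ^+ 2) _); last by move=> x; rewrite sqr_ge0.
apply: ler_sum => x _; apply: le_trans (sqr_average_le _ _ _).
by rewrite ler_pXn2r ?nnegrE ?norm_average_le // (le_trans _ (norm_average_le _ _ _)).
Qed.

End Contraction.

Section Displacement.
Variables (R : realType) (Q : groupType) (finQ : finite_set [set: Q]).

Lemma l2sq_real (f : Q -> R^o) : l2sq f = \sum_(x <- elts [set: Q]) f x ^+ 2.
Proof. by apply: eq_bigr => x _; rewrite real_normK ?num_real. Qed.

(** The variance identity bounds the mean over [s] of [|f(. s) - average l f|^2] by
    [|f|^2 - |average l f|^2]; comparing the terms [s] and [1] gives the bound. *)
Lemma displacement_le (l : seq Q) (f : Q -> R^o) s : s \in l -> 1%g \in l ->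
  l2sq (fun x => f (x * s)%g - f x) <=
  4 * (size l)%:R * (l2sq f - l2sq (average l f)).
Proof.
move=> sl l1; have l0 : (0 < size l)%N by case: (l) sl.
pose D t := \sum_(x <- elts [set: Q]) (f (x * t)%g - average l f x) ^+ 2.
have D0 t : 0 <= D t by apply: sumr_ge0 => x _; exact: sqr_ge0.
have sumD : \sum_(t <- l) D t <= (size l)%:R * (l2sq f - l2sq (average l f)).
  rewrite exchange_big /= -ler_pdivrMl ?ltr0n // mulr_sumr !l2sq_real.
  rewrite (eq_bigr (fun x => average l (fun y => f y ^+ 2 : R^o) x - average l f x ^+ 2)).
    by rewrite sumrB lerB // (sum_average_le finQ) // => x; rewrite sqr_ge0.
  by move=> x _; rewrite -average_variance.
have leD t : t \in l -> D t <= (size l)%:R * (l2sq f - l2sq (average l f)).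
  move=> tl; apply: le_trans sumD; rewrite (big_rem t) //= lerDl.
  by rewrite sumr_ge0.
rewrite l2sq_real; apply: (@le_trans _ _ (2 * D s + 2 * D 1%g)).
  rewrite !mulr_sumr -big_split /=; apply: ler_sum => x _; rewrite mulg1.
  set a := average _ _ _; set b := f _; set c := f _.
  have := sqr_ge0 (b - a + (c - a)); rewrite !expr2; lra.
have := leD _ sl; have := leD _ l1; lra.
Qed.

End Displacement.

(** * A representation containing a sequence of finite quotients *)

Section BlockRepresentation.
Variables (R : realType) (G : groupType) (M : nat -> normalSubgroup G).
Hypothesis finM : forall j, finite_index (M j).

Let I : choiceType := {j : nat & quotientGroup (M j)}.
Local Notation Q j := (quotientGroup (M j)).

(** [G] acts on each quotient by right translations, so that [u |-> u \o shift g] is a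
    left action on functions. *)
Definition shift (g : G) (i : I) : I :=
  Tagged (fun j => Q j) (tagged i * coset_proj (M (tag i)) g)%g.

Lemma shift1 i : shift 1%g i = i.
Proof. by case: i => j x; rewrite /shift /= mulg1. Qed.

Lemma shiftM g h i : shift h (shift g i) = shift (g * h)%g i.
Proof. by case: i => j x; rewrite /shift /= (coset_projM (M j)) mulgA. Qed.

Lemma shift_bij g : bijective (shift g).
Proof.
by exists (shift g^-1%g) => i; rewrite shiftM ?mulgV ?mulVg shift1.
Qed.

Fact shift_summable g (u : ell2 R I) :
  (fun i => u (shift g i)) \in @square_summable R I.
Proof.
by rewrite inE /sqsum (nnsum_reindex (fun i => u i ^+ 2) (shift_bij g)); exact: ell2P u.
Qed.

Definition block_rep_fun g (u : ell2_hilbert R I) : ell2_hilbert R I :=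
  Ell2 (shift_summable g u).

Let block_rep_linear g : linear (block_rep_fun g).
Proof. by move=> a u v; apply: ell2_ext. Qed.

HB.instance Definition _ g :=
  GRing.isLinear.Build R (ell2_hilbert R I) (ell2_hilbert R I) _ (block_rep_fun g)
    (block_rep_linear g).

Definition block_rep (g : G) : {linear ell2_hilbert R I -> ell2_hilbert R I} :=
  block_rep_fun g.

Lemma sqnorm_block_rep g u : sqnorm (block_rep g u) = sqnorm u.
Proof.
by congr fine; rewrite /sqsum (nnsum_reindex (fun i => u i ^+ 2) (shift_bij g)).
Qed.

Lemma block_rep_orthogonal : orthogonal_rep block_rep.
Proof.
split=> [v|g h v|g v w].
- by apply: ell2_ext => i; rewrite /= shift1.
- by apply: ell2_ext => i; rewrite /= shiftM.
- by rewrite /= /ell2_dot -linearD !sqnorm_block_rep.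
Qed.

Implicit Types w : forall j, Q j -> R.

(** The function [w j] extended by zero outside the [j]-th quotient.  The whole family
    [w] is a parameter, so that no cast is needed to evaluate it at [i]. *)
Definition block_fun w j (i : I) : R^o :=
  if tag i == j then w (tag i) (tagged i) else 0.

Lemma block_nnsum w j :
  nnsum (fun i => block_fun w j i ^+ 2) = (l2sq (w j : _ -> R^o))%:E.
Proof.
pose h x : I := Tagged (fun j => Q j) (x : Q j).
rewrite (@nnsum_support _ _ (h @` setT)).
- rewrite fsbig_image; last by move=> x y _ _ /eqP; rewrite eq_Tagged => /eqP.
  rewrite fsbig_finite; last exact: finM.
  rewrite (l2sq_real (w j)); congr EFin.
  by apply: eq_bigr => x _; rewrite /block_fun /= eqxx.
- exact: finite_image (finM j).
- by move=> i; exact: sqr_ge0.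
- move=> [k x] /= kj; rewrite /block_fun /=; case: eqP => [kj'|_]; last by rewrite expr0n.
  by case: kj; subst k; exists x.
Qed.

Fact block_summable w j : block_fun w j \in @square_summable R I.
Proof. by rewrite inE /sqsum block_nnsum ltry. Qed.

Definition block w j : ell2_hilbert R I := Ell2 (block_summable w j).

Lemma block_norm w j : `|block w j| ^+ 2 = l2sq (w j : _ -> R^o).
Proof.
apply: etrans (ell2_norm (block w j)) _; apply: EFin_inj; rewrite sqnormE; exact: block_nnsum.
Qed.

Lemma block_displacement w j g :
  `|block_rep g (block w j) - block w j| ^+ 2 =
  l2sq (fun x => w j (x * coset_proj (M j) g)%g - w j x : R^o).
Proof.
rewrite -(block_norm (fun k x => w k (x * coset_proj (M k) g)%g - w k x)).
congr (`| _ | ^+ 2); apply: ell2_ext => i.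
(* [shift g] preserves the blocks, so the difference is computed in block [j]. *)
change (block_fun w j (shift g i) - block_fun w j i =
  block_fun (fun k x => w k (x * coset_proj (M k) g)%g - w k x) j i).
by rewrite /block_fun /=; case: ifP; rewrite ?subr0.
Qed.

End BlockRepresentation.

(** * The spectral gap given by relative property (T) *)
Section AlmostInvariant.
Variables (R : realType) (G : groupType) (S : set G) (genS : generates S).
Variables (V : hilbertType R) (pi : G -> {linear V -> V}).
Hypothesis orth : orthogonal_rep pi.

Lemma rep_norm g u : `|pi g u| = `|u|.
Proof.
apply/eqP; rewrite -(eqrXn2 (isT : 0 < 2)%N) // !hdot_norm.
by case: orth => _ _ ->.
Qed.

(** A sequence that is almost invariant under generators is almost invariant
    under each element, since the displacement of a product is at most the sum of
    the displacements. *)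
Lemma almost_invariant (v : nat -> V) :
  (forall s, S s -> `|pi s (v n) - v n| @[n --> \oo] --> (0 : R)) ->
  forall g, `|pi g (v n) - v n| @[n --> \oo] --> (0 : R).
Proof.
case: orth => pi1 piM _ vS g; have [w [Sw <-]] := genS g.
elim: w Sw => [|s w IHw] Sw.
  rewrite big_nil; under eq_fun do rewrite pi1 subrr normr0.
  exact: cvg_cst.
rewrite big_cons; set h := (\prod_(t <- w) t)%g.
have s0 : `|pi s (v n) - v n| @[n --> \oo] --> (0 : R).
  have [/vS //|/vS Ss] := Sw s (mem_head _ _).
  rewrite (_ : (fun n => _) = fun n => `|pi s^-1%g (v n) - v n|) //.
  apply/funext => n; rewrite -(rep_norm s^-1%g) linearB /= -piM mulVg pi1.
  exact: distrC.
have h0 : `|pi h (v n) - v n| @[n --> \oo] --> (0 : R).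
  by apply: IHw => t tw; apply: Sw; rewrite inE tw orbT.
have sh0 : `|pi h (v n) - v n| + `|pi s (v n) - v n| @[n --> \oo] --> (0 : R).
  by rewrite -[X in _ --> X]addr0; exact: cvgD.
apply: squeeze_cvgr (cvg_cst 0) sh0; apply: nearW => n; rewrite normr_ge0 /=.
rewrite piM -[in leRHS](rep_norm s (pi h (v n) - v n)) linearB /=.
by rewrite -[in leLHS](subrKA (pi s (v n))) ler_normD.
Qed.

End AlmostInvariant.

Lemma sqr_harmonic_cvg0 (R : realType) (a : nat -> R) (C : R) :
  (forall n, 0 <= a n) -> (forall n, a n ^+ 2 <= C * n.+1%:R^-1) ->
  a @ \oo --> (0 : R).
Proof.
move=> a0 aC; apply/cvgrPdist_le => e e0.
have Ch : (fun n => C * n.+1%:R^-1) @ \oo --> (0 : R).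
  by rewrite -[X in _ --> X](mulr0 C); apply: cvgMr; exact: cvg_harmonic.
have e2 : 0 < e ^+ 2 by rewrite exprn_gt0.
move/cvgrPdist_le: Ch => /(_ _ e2); apply: filterS => n.
rewrite !sub0r !normrN => h; rewrite (ger0_norm (a0 n)).
rewrite -(ler_pXn2r (isT : 0 < 2)%N) ?nnegrE ?(ltW e0) //.
by apply: le_trans (aC n) _; apply: le_trans h; exact: ler_norm.
Qed.

Lemma coset_proj1 (G : groupType) (N : normalSubgroup G) : coset_proj N 1%g = 1%g.
Proof. by []. Qed.

Section SpectralGap.
Variables (R : realType) (G : groupType) (S : set G) (genS : generates S).
Variable H : normalSubgroup G.

Definition coset_image (N : normalSubgroup G) : set (quotientGroup N) := coset_proj N @` H.
Arguments coset_image N _ : clear implicits.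

Section Quotient.
Variable N : normalSubgroup G.
Hypothesis finN : finite_index N.

Lemma coset_image_finite : finite_set (coset_image N).
Proof. exact: sub_finite_set finN. Qed.

Lemma coset_image1 : coset_image N 1%g.
Proof. by exists 1%g => //; exact: nsg1. Qed.

Lemma coset_imageM y z : coset_image N y -> coset_image N z -> coset_image N (y * z)%g.
Proof.
move=> [g Hg <-] [h Hh <-]; exists (g * h)%g; first exact: nsgM.
exact: coset_projM.
Qed.

Lemma coset_imageJ y z : coset_image N y -> coset_image N (y ^ z)%g.
Proof.
move=> [g Hg <-]; exists (g ^ repr z)%g; first exact: nsg_conj.
by rewrite /conjg !coset_projM coset_projV coset_repr.
Qed.

(** If every translate [v(. h)] stays within distance [1] of the unit vector [v],
    all the inner products of [v] with its translates are positive, so their mean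
    cannot vanish. *)
Lemma mean0_displaced (v : quotientGroup N -> R^o) : l2sq v = 1 ->
  (forall x, average (elts (coset_image N)) v x = 0) ->
  exists2 h, nsg_carrier H h & 1 <= l2sq (fun x => v (x * coset_proj N h)%g - v x).
Proof.
move=> v1 Pv; apply: contrapT => no_h.
have small h : nsg_carrier H h -> 1 / 2 < \sum_(x <- elts setT) v x * v (x * coset_proj N h)%g.
  move=> Hh; have : l2sq (fun x => v (x * coset_proj N h)%g - v x) < 1.
    by rewrite ltNge; apply/negP => ?; apply: no_h; exists h.
  have e : l2sq (fun x => v (x * coset_proj N h)%g - v x) =
      l2sq v + l2sq v - 2 * \sum_(x <- elts setT) v x * v (x * coset_proj N h)%g.
    rewrite !l2sq_real mulr_sumr.
    rewrite -{1}(sum_translate finN (fun x => v x ^+ 2) (coset_proj N h)) -big_split -sumrB.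
    by apply: eq_bigr => x _ /=; ring.
  by rewrite e v1; lra.
have im1 : 1%g \in elts (coset_image N).
  by apply/eltsP; [exact: coset_image_finite|exact: coset_image1].
have sz0 : (size (elts (coset_image N)))%:R != 0 :> R.
  by rewrite pnatr_eq0 size_eq0; apply/eqP => e; rewrite e in im1.
have sum0 x : \sum_(h <- elts (coset_image N)) v (x * h)%g = 0.
  move/eqP: (Pv x); rewrite /average scaler_eq0 invr_eq0 (negbTE sz0) /=.
  by move/eqP.
have : 0 < \sum_(h <- elts (coset_image N)) \sum_(x <- elts setT) v x * v (x * h)%g.
  have pos h : h \in elts (coset_image N) -> 0 < \sum_(x <- elts setT) v x * v (x * h)%g.
    move=> /(eltsP _ coset_image_finite)[g Hg <-]; apply: lt_trans (small g Hg).
    by rewrite divr_gt0.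
  rewrite (big_rem 1%g) //= ltr_pwDl ?pos // big_seq sumr_ge0 // => h.
  by move=> /mem_rem /pos /ltW.
rewrite exchange_big /= big1 ?ltxx // => x _.
by rewrite -mulr_sumr sum0 mulr0.
Qed.

Lemma l2sqZ (Q : groupType) (c : R) (v : Q -> R^o) :
  l2sq (fun x => c * v x : R^o) = c ^+ 2 * l2sq v.
Proof. by rewrite !l2sq_real mulr_sumr; apply: eq_bigr => x _; rewrite exprMn. Qed.

Lemma averageZ (Q : groupType) l (c : R) (v : Q -> R^o) x :
  average l (fun x => c * v x : R^o) x = c * average l v x.
Proof. by rewrite /average -mulr_sumr /GRing.scale /= mulrCA. Qed.

(** Failure of the gap at [v] forces [v] to be nonzero, since averages are contractions;
    homogeneity then gives a unit vector. *)
Lemma gap_normalize (l : seq (quotientGroup N)) (c : R) (v : quotientGroup N -> R^o) :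
  0 <= c -> (forall x, average (elts (coset_image N)) v x = 0) ->
  c * l2sq v < l2sq (average l v) ->
  exists w : quotientGroup N -> R^o,
    [/\ l2sq w = 1, forall x, average (elts (coset_image N)) w x = 0 &
       c < l2sq (average l w)].
Proof.
move=> c0 Pv cv; have v0 : 0 < l2sq v.
  apply: lt_le_trans (l2sq_average_le finN l v); apply: le_lt_trans cv.
  by rewrite mulr_ge0 ?l2sq_ge0.
pose a := (Num.sqrt (l2sq v))^-1; have a2 : a ^+ 2 = (l2sq v)^-1.
  by rewrite exprVn sqr_sqrtr // ltW.
exists (fun x => a * v x); split.
- by rewrite l2sqZ a2 mulVf // gt_eqF.
- by move=> x; rewrite averageZ Pv mulr0.
- rewrite (_ : average _ _ = fun x => a * average l v x); last first.
    by apply/funext => x; rewrite averageZ.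
  by rewrite l2sqZ a2 ltr_pdivlMl // mulrC.
Qed.

End Quotient.

Hypothesis relT : relative_property_T R H.
Variables (N : nat -> normalSubgroup G) (finN : forall n, finite_index (N n)).
Variable L : seq G.
Hypotheses (L1 : 1%g \in L) (SL : forall s, S s -> s \in L).

(** If there is no gap, choose for each [j] a unit vector of mean zero that violates
    it for [lambda = 1 - 1 / (j + 1)], in some quotient [N (m j)].  Placed in the
    blocks of one representation, these vectors contradict relative property (T),
    which speaks of a single representation. *)
Lemma spectral_gap : exists2 lambda : R, 0 <= lambda < 1 &
  forall n (v : quotientGroup (N n) -> R^o),
    (forall x, average (elts (coset_image (N n))) v x = 0) ->
    l2sq (average (map (coset_proj (N n)) L) v) <= lambda * l2sq v.
Proof.
apply: contrapT => noGap.
have bad (j : nat) : exists n (v : quotientGroup (N n) -> R^o),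
   [/\ l2sq v = 1, forall x, average (elts (coset_image (N n))) v x = 0 &
       1 - j.+1%:R^-1 < l2sq (average (map (coset_proj (N n)) L) v)].
  apply: contrapT => nobad; apply: noGap; exists (1 - j.+1%:R^-1).
    by rewrite subr_ge0 invf_le1 ?ler1n ?ltr0n //= ltrBlDr ltrDl invr_gt0.
  move=> n v Pv; rewrite leNgt; apply/negP => lt.
  have [|w wP] := gap_normalize (finN n) _ Pv lt; last by apply: nobad; exists n, w.
  by rewrite subr_ge0 invf_le1 ?ler1n ?ltr0n.
pose m j := projT1 (cid (bad j)).
pose w j : quotientGroup (N (m j)) -> R := projT1 (cid (projT2 (cid (bad j)))).
have wP j := projT2 (cid (projT2 (cid (bad j)))).
pose finM j := finN (m j); pose rep := @block_rep R G (fun j => N (m j)).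
pose v j := block finM w j.
have v1 j : `|v j| = 1.
  apply/eqP; rewrite -(eqrXn2 (isT : 0 < 2)%N) // expr1n.
  by rewrite (block_norm finM w j); case: (wP j) => ->.
have vS s : S s -> `|rep s (v n) - v n| @[n --> \oo] --> (0 : R).
  move=> Ss; apply: (@sqr_harmonic_cvg0 _ _ (4 * (size L)%:R)) => // n.
  rewrite (block_displacement finM w n s).
  apply: le_trans (displacement_le (finM n) (l := map (coset_proj (N (m n))) L) _ _ _) _.
  - by apply: map_f; exact: SL.
  - by apply/mapP; exists 1%g.
  case: (wP n) => w1 _ wA; rewrite size_map ler_wpM2l ?mulr_ge0 //.
  by rewrite -/(w n) in w1 wA *; rewrite w1 lerBlDr -lerBlDl ltW.
have vG := almost_invariant genS (@block_rep_orthogonal R G _) vS.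
have /cvgrPdist_lt/(_ _ (@ltr01 R)) [n _ /(_ n (leqnn n))] :=
  relT (@block_rep_orthogonal R G _) v1 vG.
rewrite /= sub0r normrN => sup1.
case: (wP n) => w1 Pw _; have [h Hh] := mean0_displaced (finM n) w1 Pw.
rewrite -(block_displacement finM w n h); apply/negP; rewrite -ltNge.
rewrite -[ltRHS](expr1n _ 2) ltr_pXn2r ?nnegrE //.
apply: le_lt_trans sup1; apply: le_trans (ler_norm _).
apply: ub_le_sup; last by exists h.
(* The supremum bounds its terms because displacements of unit vectors are at most 2. *)
exists 2 => _ [g Hg <-]; apply: le_trans (ler_normB _ _) _.
by rewrite (rep_norm (@block_rep_orthogonal R G _)) v1.
Qed.

End SpectralGap.

(** * Finite groups as measure spaces *)
(** A copy of [Q], to carry the discrete sigma-algebra. *)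
Definition discrete (Q : groupType) : Type := Q.

Section Discrete.
Variable Q : groupType.
HB.instance Definition _ := Choice.on (discrete Q).
HB.instance Definition _ := isPointed.Build (discrete Q) (1%g : Q).
HB.instance Definition _ := @isMeasurable.Build default_measure_display (discrete Q)
  discrete_measurable discrete_measurable0 discrete_measurableC discrete_measurableU.
End Discrete.

Section CountingMeasure.
Variables (R : realType) (Q : groupType) (finQ : finite_set [set: Q]).
Local Notation W := (discrete Q).
Local Notation E := (elts [set: Q]).

Lemma measurable_discrete d (T : measurableType d) (f : W -> T) :
  measurable_fun setT f.
Proof. by move=> _ A _. Qed.

Definition point_mass (n : nat) : {measure set W -> \bar R} := dirac (nth 1%g E n : W).

(** The counting measure, written as a finite sum of Dirac measures so that integrals
    are finite sums of values. *)
Definition card_measure : {measure set W -> \bar R} := msum point_mass (size E).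

Lemma integral_card_measure (f : W -> \bar R) : (forall x, 0 <= f x)%E ->
  (\int[card_measure]_x f x = \sum_(x <- E) f x)%E.
Proof.
move=> f0; rewrite ge0_integral_measure_sum //.
rewrite (big_nth 1%g) big_mkord; apply: eq_bigr => n _.
rewrite integral_dirac //.
by rewrite diracT mul1e.
Qed.

(** Every point is an atom, so almost everywhere means everywhere. *)
Lemma ae_card_measure (P : set W) : {ae card_measure, forall x, P x} <-> forall x, P x.
Proof.
split=> [[A [_ A0 PA]] x|Px]; last by apply: nearW.
apply: contrapT => nPx; have Ax := PA x nPx.
have xE : (x : Q) \in E by apply/eltsP.
have xlt : (index (x : Q) E < size E)%N by rewrite index_mem.
have : (1 <= card_measure A)%E.
  rewrite /card_measure /= /msum (bigD1 (Ordinal xlt)) //=.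
  rewrite diracE mem_set; last by rewrite nth_index.
  by rewrite leeDl // sume_ge0.
by rewrite A0 lee_fin ler10.
Qed.

Lemma card_measure_gt0 : (0 < card_measure [set: W])%E.
Proof.
rewrite lt0e measure_ge0 andbT; apply/eqP => c0.
have [] : forall x : W, False; last exact: (1%g : Q).
by apply/ae_card_measure; exists setT; split.
Qed.

Lemma Lnorm1_card_measure (f : W -> R) :
  ('N[card_measure]_1%:E[EFin \o f] = (\sum_(x <- E) `|f x|)%:E)%E.
Proof.
rewrite Lnorm1 integral_card_measure // -sumEFin.
by apply: eq_bigr.
Qed.

Lemma Lnorm2_card_measure (f : W -> R) :
  ('N[card_measure]_2%:E[EFin \o f] = (Num.sqrt (l2sq (f : Q -> R^o)))%:E)%E.
Proof.
rewrite unlock integral_card_measure => [|x]; last exact: poweR_ge0.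
rewrite (eq_bigr (fun x => (`|f x| ^+ 2)%:E)) => [|x _].
  by rewrite sumEFin poweR_EFin powR12_sqrt // sumr_ge0 // => x _; rewrite sqr_ge0.
by rewrite /= -powR_mulrn.
Qed.

(** The hypothesis expresses the comparison of supremum norms without mentioning a
    supremum. *)
Lemma Lnormy_card_measure_le (f g : W -> R) :
  (forall c, (forall x, `|g x| <= c) -> forall x, `|f x| <= c) ->
  ('N[card_measure]_+oo%E[EFin \o f] <= 'N[card_measure]_+oo%E[EFin \o g])%E.
Proof.
move=> fg; rewrite unlock card_measure_gt0; apply/ess_supP.
have := ess_sup_ge card_measure (abse \o (EFin \o g)); move/ae_card_measure.
case: (ess_sup _ _) => [c gc|_|/(_ 1%g)] //; last first.
  by apply: nearW => x; rewrite leey.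
by apply: nearW => x; rewrite /= lee_fin; apply: fg => y; rewrite -lee_fin; exact: gc.
Qed.

Lemma Lfun_card_measure (f : W -> R) (p : \bar R) :
  (p = 1%:E \/ p = 2%:E) -> f \in Lfun card_measure p.
Proof.
move=> pE; apply/andP; split; rewrite inE; first exact: measurable_discrete.
rewrite /= /finite_norm; case: pE => ->.
  by rewrite Lnorm1_card_measure ltry.
by rewrite Lnorm2_card_measure ltry.
Qed.

Lemma bochner_L2_card_measure (X : normedModType R) (F : W -> X) : bochner_L2 card_measure F.
Proof.
split; last by apply: Lfun_card_measure; right.
exists (fun=> F); split=> [n|w]; last exact: cvg_cst.
split=> //; apply: sub_finite_set (finite_image F finQ) => _ [x _ <-].
by exists x.
Qed.

End CountingMeasure.

(** * Uniform curvature on finite groups *)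
Definition linear_op (R : realType) (Q : groupType) (V : normedModType R)
    (T : (Q -> V) -> Q -> V) :=
  forall (a : R) f g x, T (fun y => a *: f y + g y) x = a *: T f x + T g x.

Section TensorExtension.
Variables (R : realType) (Q : groupType) (finQ : finite_set [set: Q]).
Variable X : normedModType R.

(** A vector-valued function on a finite set is a sum of point masses with
    coefficients in [X]; hence an operator on scalar functions has only one linear
    extension to vector-valued functions. *)
Lemma linear_op_ext (T1 T2 : (Q -> X) -> Q -> X) :
  linear_op T1 -> linear_op T2 ->
  (forall (f : Q -> R) v x, T1 (fun y => f y *: v) x = T2 (fun y => f y *: v) x) ->
  forall F x, T1 F x = T2 F x.
Proof.
move=> lin1 lin2 T12 F.
pose delta (y : Q) (x : Q) : R := (x == y)%:R.
have FE : F = fun x => \sum_(y <- elts [set: Q]) delta y x *: F y.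
  apply/funext => x; rewrite (bigD1_seq x) ?uniq_elts //=; last exact/eltsP.
  rewrite /delta eqxx scale1r big1 ?addr0 // => y yx.
  by rewrite eq_sym (negbTE yx) scale0r.
rewrite {1 2}FE; elim: (elts _) => [|y s IHs] x.
  have e : (fun x : Q => \sum_(y <- [::]) delta y x *: F y) = fun=> 0 *: 0.
    by apply/funext => z; rewrite big_nil scale0r.
  by rewrite e.
have e : (fun x : Q => \sum_(z <- y :: s) delta z x *: F z) =
    fun x => 1 *: (delta y x *: F y) + \sum_(z <- s) delta z x *: F z.
  by apply/funext => z; rewrite big_cons scale1r.
by rewrite e lin1 lin2 IHs T12.
Qed.

End TensorExtension.

(** On a finite set with its counting measure, the extension of [T] provided by uniform
    curvature is, by [linear_op_ext], any linear [TX] that agrees with [T] on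
    functions of rank one. *)
Lemma uniformly_curved_finite (R : realType) (X : completeNormedModType R) :
  uniformly_curved X -> exists Delta : R -> R, Delta eps @[eps --> 0^'+] --> (0 : R) /\
  forall eps : R, 0 < eps ->
  forall (Q : groupType) (finQ : finite_set [set: Q])
    (T : (Q -> R^o) -> Q -> R^o) (TX : (Q -> X) -> Q -> X),
    linear_op T -> linear_op TX ->
    (forall (f : Q -> R) v x, TX (fun y => f y *: v) x = T f x *: v) ->
    (forall f, l2sq (T f) <= eps ^+ 2 * l2sq f) ->
    (forall f, \sum_(x <- elts [set: Q]) `|T f x| <= \sum_(x <- elts [set: Q]) `|f x|) ->
    (forall f c, (forall x, `|f x| <= c) -> forall x, `|T f x| <= c) ->
    forall F, Num.sqrt (l2sq (TX F)) <= Delta eps * Num.sqrt (l2sq F).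
Proof.
move=> [Delta [Delta0 curved]]; exists Delta; split=> //.
move=> eps e0 Q finQ T TX linT linX TXE T2 T1 Ty F.
have [||||TY [[[_ _ linY] TYE] TY2]] := curved eps e0 _ (discrete Q) (card_measure R Q) T.
- split=> [f _|f g _ _ /ae_card_measure fg|a f g _ _].
  + by apply: Lfun_card_measure => //; right.
  + suff -> : f = g by apply: nearW.
    by apply/funext => x; exact: (fg finQ).
  + by apply: nearW => x _; exact: linT.
- move=> f _ _; rewrite !Lnorm2_card_measure // -EFinM lee_fin.
  rewrite -[eps in leRHS]gtr0_norm // -sqrtr_sqr -sqrtrM ?sqr_ge0 //.
  exact/ler_wsqrtr/T2.
- by move=> f _ _; rewrite !Lnorm1_card_measure // mul1e lee_fin; exact: T1.
- by move=> f _ _; rewrite mul1e; apply: Lnormy_card_measure_le => // c fc x; exact: (Ty f).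
have BL (F' : discrete Q -> X) : bochner_L2 (card_measure R Q) F'.
  exact: bochner_L2_card_measure.
have TXY : TX F = TY F.
  apply/funext; apply: (linear_op_ext finQ) => [//|a f g x|f v x].
    by have /ae_card_measure := linY a _ _ (BL f) (BL g); exact.
  have fL : scalar_L2 (card_measure R Q) f by apply: Lfun_card_measure => //; right.
  by rewrite TXE; have /ae_card_measure := TYE f v fL; move=> ->.
have := TY2 F (BL F); rewrite !Lnorm2_card_measure // -EFinM lee_fin -TXY.
have normE (F' : Q -> X) : l2sq (fun x => `|F' x| : R^o) = l2sq F'.
  by apply: eq_bigr => x _; rewrite normr_id.
by rewrite !normE.
Qed.

(** * A Poincare inequality for the cosets of a normal subgroup *)
Section Walk.
Variables (R : realType) (Q : groupType) (finQ : finite_set [set: Q]).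
Variable l : seq Q.
Hypothesis l0 : (0 < size l)%N.

(** The operator of [k] steps of the random walk with steps uniform in [l]. *)
Definition walk (V : normedModType R) (k : nat) (f : Q -> V) : Q -> V :=
  iter k (average l) f.

Section Vector.
Variable V : normedModType R.
Implicit Types f g : Q -> V.

Lemma average_sup_le l' f (c : R) : (0 < size l')%N ->
  (forall x, `|f x| <= c) -> forall x, `|average l' f x| <= c.
Proof.
move=> l'0 fc x; rewrite /average normrZ ger0_norm ?invr_ge0 ?ler0n //.
rewrite ler_pdivrMl ?ltr0n //; apply: le_trans (ler_norm_sum _ _ _) _.
apply: le_trans (ler_sum _ (fun s _ => fc (x * s)%g)) _.
by rewrite big_const_seq count_predT iter_addr_0 mulr_natl.
Qed.

Lemma walk_sup_le k f (c : R) :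
  (forall x, `|f x| <= c) -> forall x, `|walk k f x| <= c.
Proof. by move=> fc; elim: k => //= k IHk; exact: average_sup_le. Qed.

Lemma walk_linear k : linear_op (@walk V k).
Proof.
move=> a f g; elim: k => // k IHk x; rewrite /walk !iterS -!/(walk _ _).
by rewrite (funext IHk) average_linear.
Qed.

Lemma walkB k f g x : walk k (fun y => f y - g y) x = walk k f x - walk k g x.
Proof.
rewrite (_ : (fun y => _) = fun y => -1 *: g y + f y); last first.
  by apply/funext => y; rewrite scaleN1r addrC.
by rewrite walk_linear scaleN1r addrC.
Qed.

Lemma walk0 k x : walk k (fun=> 0 : V) x = 0.
Proof. by rewrite -[RHS](subrr (walk k (fun=> 0 : V) x)) -walkB subrr. Qed.

(** Each further step adds at most [c], as one step moves [f] by at most [c] and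
    averaging is a contraction for the supremum norm. *)
Lemma walk_dist_le k f (c : R) : (forall s x, s \in l -> `|f x - f (x * s)%g| <= c) ->
  forall x, `|f x - walk k f x| <= k%:R * c.
Proof.
move=> fc; elim: k => [|k IHk] x; first by rewrite /walk /= subrr normr0 mul0r.
rewrite -(subrKA (average l f x)) -natr1 mulrDl mul1r addrC.
apply: le_trans (ler_normD _ _) _; apply: lerD.
  by rewrite /walk iterS -averageB; exact: average_sup_le.
by apply: average_dist_le => // s sl; exact: fc.
Qed.

Lemma walk_average (A : set Q) k f x : finite_set A ->
  (forall y z, A y -> A (y ^ z)%g) ->
  average (elts A) (walk k f) x = walk k (average (elts A) f) x.
Proof.
move=> finA nA; elim: k x => // k IHk x; rewrite /walk !iterS -!/(walk _ _).
by rewrite (average_comm l (walk k f) x finA nA) (funext IHk).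
Qed.

End Vector.

Lemma average_scale (V : normedModType R) l' (f : Q -> R^o) (v : V) x :
  average l' (fun y => f y *: v) x = average l' f x *: v.
Proof. by rewrite /average -scaler_suml scalerA. Qed.

Lemma walk_scale (V : normedModType R) k (f : Q -> R^o) (v : V) x :
  walk k (fun y => f y *: v) x = walk k f x *: v.
Proof.
elim: k x => // k IHk x; rewrite /walk !iterS -!/(walk _ _).
by rewrite (funext IHk) average_scale.
Qed.

Lemma sum_norm_average_le l' (f : Q -> R^o) :
  \sum_(x <- elts [set: Q]) `|average l' f x| <= \sum_(x <- elts [set: Q]) `|f x|.
Proof.
apply: le_trans (@sum_average_le _ _ finQ l' (fun x => `|f x|) _) => //.
by apply: ler_sum => x _; exact: norm_average_le.
Qed.

Lemma sum_norm_walk_le k (f : Q -> R^o) :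
  \sum_(x <- elts [set: Q]) `|walk k f x| <= \sum_(x <- elts [set: Q]) `|f x|.
Proof. by elim: k => //= k; apply: le_trans; exact: sum_norm_average_le. Qed.

End Walk.

Lemma sqr_normD_le (R : realType) (V : normedModType R) (a b : V) :
  `|a + b| ^+ 2 <= 2 * `|a| ^+ 2 + 2 * `|b| ^+ 2.
Proof.
have h : `|a + b| ^+ 2 <= (`|a| + `|b|) ^+ 2.
  by rewrite ler_pXn2r ?nnegrE ?addr_ge0 // ler_normD.
by apply: le_trans h _; have := sqr_ge0 (`|a| - `|b|); rewrite !expr2; lra.
Qed.

Lemma sqr_normB_le (R : realType) (V : normedModType R) (a b : V) :
  `|a - b| ^+ 2 <= 2 * `|a| ^+ 2 + 2 * `|b| ^+ 2.
Proof. by apply: le_trans (sqr_normD_le _ _) _; rewrite normrN. Qed.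

Section Poincare.
Variables (R : realType) (Q : groupType) (finQ : finite_set [set: Q]).
Variables (l : seq Q) (A : set Q).
Hypotheses (l1 : 1%g \in l) (A1 : A 1%g).
Hypotheses (AM : forall y z, A y -> A z -> A (y * z)%g).
Hypotheses (AJ : forall y z, A y -> A (y ^ z)%g).
Variable lambda : R.
Hypothesis lambda0 : 0 <= lambda.
Hypothesis gap : forall v : Q -> R^o, (forall x, average (elts A) v x = 0) ->
  l2sq (average l v) <= lambda * l2sq v.

Let finA : finite_set A. Proof. exact: sub_finite_set finQ. Qed.
Let l0 : (0 < size l)%N. Proof. by case: l l1. Qed.
Let eA0 : (0 < size (elts A))%N.
Proof. by have /(eltsP _ finA) := A1; case: (elts A). Qed.

Definition defect (V : normedModType R) (f : Q -> V) : Q -> V :=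
  fun x => f x - average (elts A) f x.

(** The gap can be iterated because the walk preserves the functions of mean zero on
    the cosets of [A]. *)
Lemma walk_gap k (v : Q -> R^o) : (forall x, average (elts A) v x = 0) ->
  l2sq (walk l k v) <= lambda ^+ k * l2sq v.
Proof.
move=> v0; elim: k => [|k IHk]; first by rewrite expr0 mul1r.
rewrite exprS -mulrA /walk iterS -/(walk l k v).
apply: le_trans (ler_wpM2l lambda0 IHk); apply: gap => x.
by rewrite walk_average // (_ : average _ v = fun=> 0) ?walk0 //; exact/funext.
Qed.

(** The factor 1/2 makes this a contraction for the L^1 and L^oo norms: the defect is
    a difference of two contractions. *)
Definition smoothing (V : normedModType R) k (f : Q -> V) : Q -> V :=
  fun x => 2^-1 *: walk l k (defect f) x.

Lemma defect_linear (V : normedModType R) : linear_op (@defect V).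
Proof.
move=> a f g x; rewrite /defect average_linear scalerBr opprD.
by rewrite addrACA.
Qed.

Lemma smoothing_linear (V : normedModType R) k : linear_op (@smoothing V k).
Proof.
move=> a f g x; rewrite /smoothing (funext (defect_linear a f g)) walk_linear.
by rewrite scalerDr !scalerA mulrC.
Qed.

Lemma smoothing_scale (V : normedModType R) k (f : Q -> R^o) (v : V) x :
  smoothing k (fun y => f y *: v) x = smoothing k f x *: v.
Proof.
rewrite /smoothing (_ : defect _ = fun y => defect f y *: v).
  by rewrite walk_scale scalerA.
by apply/funext => y; rewrite /defect average_scale scalerBl.
Qed.

Lemma l2sq_half (V : normedModType R) (f : Q -> V) :
  l2sq (fun x => 2^-1 *: f x) = 4^-1 * l2sq f.
Proof.
rewrite /l2sq mulr_sumr; apply: eq_bigr => x _.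
by rewrite normrZ exprMn ger0_norm ?invr_ge0 //; congr (_ * _); field.
Qed.

Lemma l2sq_defect_le (V : normedModType R) (f : Q -> V) : l2sq (defect f) <= 4 * l2sq f.
Proof.
apply: (@le_trans _ _ (2 * l2sq f + 2 * l2sq (average (elts A) f))).
  rewrite /l2sq !mulr_sumr -big_split /=; apply: ler_sum => x _; exact: sqr_normB_le.
by have := l2sq_average_le finQ (elts A) f; lra.
Qed.

Lemma smoothing_l2 k (eps : R) (f : Q -> R^o) : lambda ^+ k <= eps ^+ 2 ->
  l2sq (smoothing k f) <= eps ^+ 2 * l2sq f.
Proof.
move=> lek; rewrite l2sq_half ler_pdivrMl //.
apply: le_trans (walk_gap _ (fun x => average_defect f x finA A1 AM)) _.
have d0 : 0 <= l2sq (defect f) := l2sq_ge0 _.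
apply: le_trans (ler_wpM2r d0 lek) _; rewrite mulrCA.
by rewrite ler_wpM2l ?sqr_ge0 // l2sq_defect_le.
Qed.

Lemma smoothing_l1 k (f : Q -> R^o) :
  \sum_(x <- elts [set: Q]) `|smoothing k f x| <= \sum_(x <- elts [set: Q]) `|f x|.
Proof.
under eq_bigr do rewrite normrZ ger0_norm ?invr_ge0 //.
rewrite -mulr_sumr ler_pdivrMl //.
apply: le_trans (sum_norm_walk_le finQ l k (defect f)) _.
apply: (@le_trans _ _ (\sum_(x <- elts [set: Q]) (`|f x| + `|average (elts A) f x|))).
  by apply: ler_sum => x _; exact: ler_normB.
by rewrite big_split /=; have := sum_norm_average_le finQ (elts A) f; lra.
Qed.

Lemma smoothing_sup k (f : Q -> R^o) (c : R) :
  (forall x, `|f x| <= c) -> forall x, `|smoothing k f x| <= c.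
Proof.
move=> fc x; rewrite normrZ ger0_norm ?invr_ge0 // ler_pdivrMl //.
apply: walk_sup_le => // y; apply: le_trans (ler_normB _ _) _.
by have := average_sup_le eA0 fc y; have := fc y; lra.
Qed.

Variables (X : normedModType R) (k : nat) (F : Q -> X) (c : R).
Hypothesis contract : forall f : Q -> X,
  Num.sqrt (l2sq (smoothing k f)) <= 4^-1 * Num.sqrt (l2sq f).
Hypothesis FL : forall s x, s \in l -> `|F x - F (x * s)%g| <= c.

(** Functions of mean zero on the cosets are their own defect, so the factor 1/4 for
    the smoothing operator is 1/2 for the walk, and 1/4 for the squared norms. *)
Lemma walk_contract (g : Q -> X) : (forall x, average (elts A) g x = 0) ->
  l2sq (walk l k g) <= 4^-1 * l2sq g.
Proof.
move=> g0; have dg : defect g = g by apply/funext => x; rewrite /defect g0 subr0.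
have : Num.sqrt (l2sq (smoothing k g)) ^+ 2 <= (4^-1 * Num.sqrt (l2sq g)) ^+ 2.
  by rewrite ler_pXn2r ?nnegrE ?mulr_ge0 ?sqrtr_ge0 ?invr_ge0.
rewrite exprMn !sqr_sqrtr ?l2sq_ge0 // /smoothing dg l2sq_half.
by have := l2sq_ge0 g; rewrite expr2; lra.
Qed.

(** Walk and coset mean commute, so this is the defect of [F - walk l k F], which is
    bounded by [k c]. *)
Lemma defect_walk_le x : `|defect F x - walk l k (defect F) x| <= 2 * (k%:R * c).
Proof.
have Dc y := walk_dist_le l0 k FL y.
have -> : defect F x - walk l k (defect F) x = defect (fun y => F y - walk l k F y) x.
  rewrite /defect walkB averageB -walk_average // !opprB addrACA [RHS]addrACA.
  by congr (_ + _); rewrite addrC.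
apply: le_trans (ler_normB _ _) _.
by have := average_sup_le eA0 Dc x; have := Dc x; lra.
Qed.

(** A Poincare inequality.  Split [g = defect F] as [(g - walk g) + walk g]: the first
    term is bounded pointwise, and the contribution of the second is absorbed on the
    left. *)
Lemma defect_l2_le : l2sq (defect F) <= (size (elts [set: Q]))%:R * (4 * (k%:R * c)) ^+ 2.
Proof.
set g := defect F; set b := k%:R * c; set n := (size _)%:R.
have g0 x : average (elts A) g x = 0 := average_defect F x finA A1 AM.
have h : l2sq g <= n * (2 * (2 * b) ^+ 2) + 2 * l2sq (walk l k g).
  rewrite /n mulr_natl -count_predT -iter_addr_0 -big_const_seq mulr_sumr -big_split.
  apply: ler_sum => x _; rewrite -[X in `|X| ^+ 2](subrK (walk l k g x)).
  apply: le_trans (sqr_normD_le _ _) _; rewrite lerD2r ler_pM2l //.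
  by rewrite ler_pXn2r ?nnegrE ?(le_trans _ (defect_walk_le x)) // defect_walk_le.
have := walk_contract g0; rewrite !expr2 in h *; nra.
Qed.

(** The coset means of [F] at [x] and [x h] agree, so the mean square over [x] of
    [`|F x - F (x h)|] is controlled by [defect_l2_le], and some [x] does at least as
    well as the mean. *)
Lemma close_pair h : A h -> exists x, `|F x - F (x * h)%g| <= 8 * (k%:R * c).
Proof.
move=> Ah; apply: contrapT => far.
set b := k%:R * c in far *.
have b0 : 0 <= b by exact: le_trans (walk_dist_le l0 k FL 1%g).
have farx x : 8 * b < `|F x - F (x * h)%g|.
  by rewrite ltNge; apply/negP => ?; apply: far; exists x.
have Fg x : F x - F (x * h)%g = defect F x - defect F (x * h)%g.
  rewrite /defect (average_invariant F x finA AM Ah).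
  by rewrite opprB addrA subrK.
have le4 : \sum_(x <- elts [set: Q]) `|F x - F (x * h)%g| ^+ 2 <= 4 * l2sq (defect F).
  have -> : 4 * l2sq (defect F) = 2 * l2sq (defect F) + 2 * l2sq (defect F) by ring.
  rewrite {2}/l2sq -(sum_translate finQ (fun x => `|defect F x| ^+ 2) h) !mulr_sumr.
  rewrite -big_split; apply: ler_sum => x _; rewrite Fg; exact: sqr_normB_le.
have lt4 : (size (elts [set: Q]))%:R * (8 * b) ^+ 2 <
    \sum_(x <- elts [set: Q]) `|F x - F (x * h)%g| ^+ 2.
  have lt x : (8 * b) ^+ 2 < `|F x - F (x * h)%g| ^+ 2.
    by rewrite ltr_pXn2r ?nnegrE ?farx ?normr_ge0 // (mulr_ge0 _ b0).
  rewrite mulr_natl -count_predT -iter_addr_0 -big_const_seq.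
  have in1 : 1%g \in elts [set: Q] by apply/eltsP.
  rewrite (big_rem 1%g) //= [ltRHS](big_rem 1%g) //=.
  by apply: ltr_leD => //; apply: ler_sum => x _; exact: ltW.
have := defect_l2_le; rewrite -/b; rewrite !expr2 in lt4 *; nra.
Qed.

End Poincare.

(** * Word balls and coarse embeddings *)
Section Balls.
Variables (G : groupType) (S : set G) (finS : finite_set S).

Definition ball_words (M : nat) : set G :=
  [set x | exists w, [/\ is_word S w, (size w <= M)%N & (\prod_(s <- w) s)%g = x]].

Lemma ball_words_finite M : finite_set (ball_words M).
Proof.
have finS' : finite_set (S `|` [set s | S s^-1%g]).
  rewrite finite_setU; split=> //.
  apply: sub_finite_set (finite_image (fun s => s^-1%g) finS) => s Ss.
  by exists s^-1%g; rewrite // invgK.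
elim: M => [|M IHM].
  apply: sub_finite_set (finite_set1 (1%g : G)) => _ [w [_ + <-]].
  by rewrite leqn0 size_eq0 => /eqP ->; rewrite big_nil.
apply: (@sub_finite_set _ _ ([set 1%g] `|`
    [set (s * b)%g | s in S `|` [set s | S s^-1%g] & b in ball_words M])).
  move=> _ [[|s w] [Sw wM <-]]; first by left; rewrite big_nil.
  right; exists s; first exact: (Sw s (mem_head _ _)).
  exists (\prod_(t <- w) t)%g; last by rewrite big_cons.
  by exists w; split=> // t tw; apply: Sw; rewrite inE tw orbT.
by rewrite finite_setU; split; [exact: finite_set1|exact: finite_image2].
Qed.

(** A letter [a] with [a^-1] in the image of [S] is lifted to the inverse of an element
    of [S], so that words lift to words of the same length. *)
Lemma lift_word (N : normalSubgroup G) (w : seq (quotientGroup N)) :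
  is_word (@coset_proj G N @` S) w ->
  exists v, [/\ is_word S v, size v = size w &
    coset_proj N (\prod_(s <- v) s)%g = (\prod_(s <- w) s)%g].
Proof.
elim: w => [|a w IHw] Sw; first by exists [::]; split; rewrite // !big_nil.
have [|v [Sv sv ev]] := IHw; first by move=> t tw; apply: Sw; rewrite inE tw orbT.
have [s Ss sa] : exists2 s, S s \/ S s^-1%g & coset_proj N s = a.
  have [[s Ss <-]|[s Ss e]] := Sw a (mem_head _ _); first by exists s => //; left.
  exists s^-1%g; first by right; rewrite invgK.
  by rewrite coset_projV -[RHS]invgK -e.
exists (s :: v); split=> [t|/=|].
- by rewrite inE => /orP[/eqP ->//|]; exact: Sv.
- by rewrite sv.
- by rewrite !big_cons coset_projM ev sa.
Qed.

(** If [h] agrees modulo every [N n] with an element of a fixed finite set, then,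
    as the [N n] decrease to the trivial group, [h] belongs to that set. *)
Lemma separated_mem (N : nat -> normalSubgroup G) (B : set G) h :
  (forall n, N n.+1 `<=` N n) -> \bigcap_n (N n : set G) = [set 1%g] ->
  finite_set B -> (forall n, exists2 b, B b & coset_proj (N n) b = coset_proj (N n) h) ->
  B h.
Proof.
move=> nested triv finB hB; apply: contrapT => nBh.
have mono m n : (m <= n)%N -> N n `<=` N m.
  elim: n => [|n IHn]; first by rewrite leqn0 => /eqP ->.
  rewrite leq_eqVlt => /orP[/eqP -> //|]; rewrite ltnS => /IHn mn.
  exact: subset_trans mn.
have sep b : exists n, B b -> ~ nsg_carrier (N n) (b^-1 * h)%g.
  have [Bb|] := pselect (B b); last by exists 0%N.
  apply: contrapT => nsep; apply: nBh; suff -> : h = b by [].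
  have : (\bigcap_n (N n : set G)) (b^-1 * h)%g.
    move=> n _; apply: contrapT => nN; apply: nsep; exists n => _; exact: nN.
  by rewrite triv => /= bh; rewrite -[RHS]mulg1 -bh mulVKg.
have [f fP] := choice sep.
have [b Bb /coset_projP] := hB (\max_(b <- elts B) f b)%N.
have le : (f b <= \max_(b <- elts B) f b)%N.
  by rewrite (big_rem b) /= ?leq_maxl //; apply/eltsP.
by move/(mono _ _ le); exact: fP.
Qed.

End Balls.

Lemma exists_pow_le (R : realType) (lambda e : R) :
  0 <= lambda < 1 -> 0 < e -> exists k : nat, lambda ^+ k <= e.
Proof.
move=> /andP[l0 l1] e0.
have /cvgrPdist_le/(_ e e0)[k _ /(_ k (leqnn k))] :
    (fun n => lambda ^+ n) @ \oo --> (0 : R).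
  by apply: cvg_expr; rewrite ger0_norm.
by rewrite /= sub0r normrN ger0_norm ?exprn_ge0 // => ?; exists k.
Qed.

Lemma proper_halfline_nat (R : realType) (rho : R -> R) (C : R) :
  proper_halfline rho -> exists M : nat, forall d : nat, rho d%:R <= C -> (d <= M)%N.
Proof.
move=> [rho0 rhoB]; have [|M [_ MP]] := rhoB [set r | `|r| <= C].
  by exists C; split=> [|M CM r /= rC]; [exact: num_real|exact: le_trans rC (ltW CM)].
have MD t : 0 <= t -> rho t <= C -> t <= `|M| + 1.
  move=> t0 tC; apply: le_trans (ler_norm t) _; apply: (MP (`|M| + 1)).
    by apply: le_lt_trans (ler_norm M) _; rewrite ltrDl.
  by split=> //=; rewrite ger0_norm // rho0.
exists (Num.bound (`|M| + 1)) => d dC; rewrite -(ler_nat R).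
apply: le_trans (MD _ (ler0n _ _) dC) _; apply: ltW.
by rewrite archi_boundP // addr_ge0.
Qed.

Unset Implicit Arguments.

Theorem corollary1p2 (R : realType) (G : groupType) (S : set G)
    (finS : finite_set S) (genS : generates S)
    (H : normalSubgroup G) (infH : infinite_set H)
    (relT : relative_property_T R H)
    (N : nat -> normalSubgroup G)
    (N0 : nsg_carrier (N 0%N) = [set: G])
    (nestedN : forall n, N n.+1 `<=` N n)
    (finN : forall n, finite_index (N n))
    (trivN : \bigcap_n (N n : set G) = [set 1%g])
    (X : completeNormedModType R) (ucX : uniformly_curved X) :
  ~ coarsely_embeds (box_space R genS N) X.
Proof.
move=> [phi [rho [gamma [rhoP _ emb]]]].
pose L := 1%g :: elts S.
have L1 : 1%g \in L by rewrite mem_head.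
have SL s : S s -> s \in L by move=> Ss; rewrite inE; apply/orP; right; apply/eltsP.
have [lambda lam01 gap] := spectral_gap genS relT finN L1 SL.
have [Delta [Delta0 curved]] := uniformly_curved_finite ucX.
have [eps eps0 Deps] : exists2 eps, 0 < eps & Delta eps <= 4^-1.
  have h4 : 0 < 4^-1 :> R by rewrite invr_gt0.
  have /cvgrPdist_le/(_ _ h4) h := Delta0.
  near (0 : R)^'+ => eps; exists eps => //.
  have : `|0 - Delta eps| <= 4^-1 by near: eps.
  by rewrite sub0r normrN; apply: le_trans; exact: ler_norm.
have [k lek] := exists_pow_le lam01 (exprn_gt0 2 eps0).
have [lam0 _] := andP lam01.
(* A generator of [S] may have trivial image, hence length 0 as well as 1. *)
pose c := Num.max (gamma 0) (gamma 1).
have [M MP] := proper_halfline_nat (8 * (k%:R * c)) rhoP.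
apply: infH; apply: sub_finite_set (ball_words_finite finS M) => h Hh.
apply: (separated_mem nestedN trivN (ball_words_finite finS M)) => n.
set Q := quotientGroup (N n); pose F : Q -> X := phi n.
have dist (x y : Q) : mdist (x : box_space R genS N n) y =
  (word_length (@generates_quotient G S (N n) genS) (x^-1 * y)%g)%:R by [].
have L1' : 1%g \in map (coset_proj (N n)) L by apply/mapP; exists 1%g.
have im1 := coset_image1 H (N n); have imM := @coset_imageM G H (N n).
have imJ := @coset_imageJ G H (N n).
have contract f : Num.sqrt (l2sq (smoothing (map (coset_proj (N n)) L)
      (@coset_image G H (N n)) k (f : Q -> X))) <= 4^-1 * Num.sqrt (l2sq f).
  apply: le_trans (ler_wpM2r (sqrtr_ge0 _) Deps).
  apply: (curved _ eps0 _ (finN n) (smoothing (V := R^o) _ _ k)).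
  - exact: smoothing_linear.
  - exact: smoothing_linear.
  - exact: smoothing_scale.
  - by move=> f'; exact: (smoothing_l2 (finN n) im1 imM imJ lam0 (gap n) _ lek).
  - by move=> f'; exact: (smoothing_l1 (finN n)).
  - by move=> f' c' f_le; exact: (smoothing_sup (finN n) L1' im1 k f_le).
have FL s x : s \in map (coset_proj (N n)) L -> `|F x - F (x * s)%g| <= c.
  move=> /mapP[t tL ->]; have [_ embx] := andP (emb n x (x * coset_proj (N n) t)%g).
  apply: le_trans embx _; rewrite dist mulKg /c.
  have : (word_length (@generates_quotient G S (N n) genS) (coset_proj (N n) t) <= 1)%N.
    move: tL; rewrite inE => /orP[/eqP ->|/(eltsP _ finS) St].
      by rewrite (coset_proj1 (N n)) word_length1.
    apply: (@word_length_min _ _ _ [:: coset_proj (N n) t]); last by rewrite big_seq1.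
    by move=> u; rewrite inE => /eqP ->; left; exists t.
  case: word_length => [|[|]] // _; by rewrite le_max lexx ?orbT.
have [x Fx] : exists x, `|F x - F (x * coset_proj (N n) h)%g| <= 8 * (k%:R * c).
  apply: (close_pair (finN n) L1' im1 imM imJ contract FL).
  by exists h.
have [w [Sw sw wh]] := word_lengthP (@generates_quotient G S (N n) genS) (coset_proj (N n) h).
have [v [Sv sv vw]] := lift_word Sw.
exists (\prod_(s <- v) s)%g; last by rewrite vw wh.
exists v; split=> //; rewrite sv sw; apply: MP.
apply: le_trans Fx; have /andP[+ _] := emb n x (x * coset_proj (N n) h)%g.
by rewrite dist mulKg.
Unshelve. all: by end_near.
Qed.
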